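(* Let $Q$ be the quiver $1\xrightarrow{\alpha}2\xrightarrow{\beta}3$ and assume that the weight $v=(v_1,v_2,v_3)\in kQ_0$ is regular. Then the morphism of $kQ$-modules ${}^v\varrho^2:{}^v\Lambda_0e_2\to{}^v\Lambda_2e_2$ given by multiplication by $({}^v\varrho)^2$ is a minimal left $\operatorname{rad}^2$-approximation of $P_2={}^v\Lambda_0e_2=kQe_2$ if and only if $v_1+2v_2+v_3\neq0$ in $k$.
   Context: $k$ is a field. Paths are composed from left to right ($\alpha\beta$ is the path $1\to2\to3$), $e_i$ is the trivial path at $i$; modules are finite-dimensional left $kQ$-modules. A weight $v\in k^3$ is regular if $\sum_iv_i\dim(e_iN)\ne0$ in $k$ for every indecomposable $kQ$-module $N$; here this means $v_1,v_2,v_3,v_1+v_2,v_2+v_3,v_1+v_2+v_3$ are all non-zero. $\overline Q$ is the double quiver with additional arrows $\alpha^*:2\to1$, $\beta^*:3\to2$. Put $\rho_1=\alpha\alpha^*$, $\rho_2=-\alpha^*\alpha+\beta\beta^*$, $\rho_3=-\beta^*\beta$, ${}^v\varrho=\sum_iv_i^{-1}\rho_i$, and ${}^v\Lambda=k\overline Q/(a\,{}^v\varrho-{}^v\varrho\,a\mid a\in\{\alpha,\beta,\alpha^*,\beta^*\})$, graded by $\deg^*\alpha=\deg^*\beta=0$, $\deg^*\alpha^*=\deg^*\beta^*=1$. ${}^v\Lambda_n$ is the degree $n$ part, ${}^v\Lambda_0=kQ$; ${}^v\varrho$ is central of degree $1$. Approximations (in the category of finite-dimensional $kQ$-modules): $\operatorname{rad}(X,Y)$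 is the space of $f:X\to Y$ such that $tfs$ is not an isomorphism for all indecomposable $Z$ and $s:Z\to X$, $t:Y\to Z$; $\operatorname{rad}^2$ is the square of this ideal. A left $\operatorname{rad}^2$-approximation of $X$ is $f\in\operatorname{rad}^2(X,Y)$ such that every $g\in\operatorname{rad}^2(X,Z)$ factors as $g=h'f$; it is minimal if every endomorphism $\phi$ of $Y$ with $\phi f=f$ is an automorphism. *)

(* Defs.v *)
From HB Require Import structures.
From mathcomp Require Import all_boot all_algebra finmap zify.
From mathcomp Require Import boolp.
From mathcomp.multinomials Require Import monalg.

Set Implicit Arguments.
Unset Strict Implicit.
Unset Printing Implicit Defensive.

Import GRing.Theory.
Local Open Scope quotient_scope.
Local Open Scope ring_scope.

Lemma malg_scaleU (k : fieldType) (K : choiceType) (c : k) (p : K) :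
  << c *g p >> = c *: << p >> :> {malg k[K]}.
Proof. by apply/malgP => q; rewrite mcoeffZ !mcoeffU mulr_natr. Qed.

Record quiver := Quiver {
  vert : finType;
  arr : finType;
  src : arr -> vert;
  tgt : arr -> vert }.

Fixpoint walk (Q : quiver) (i : vert Q) (s : seq (arr Q)) : bool :=
  if s is a :: s' then (src a == i) && walk (tgt a) s' else true.

(* A path is its source together with its list of arrows, read from left to
   right; consecutive arrows a, b satisfy tgt a = src b. *)
Definition qpath (Q : quiver) := {x : vert Q * seq (arr Q) | walk x.1 x.2}.
HB.instance Definition _ (Q : quiver) := SubChoice.on (qpath Q).

Section Paths.
Variable Q : quiver.
Implicit Types (p q r : qpath Q) (i : vert Q) (a : arr Q).

Definition psrc p : vert Q := (val p).1.
Definition parrs p : seq (arr Q) := (val p).2.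
Definition ptgt p : vert Q := last (psrc p) (map (@tgt Q) (parrs p)).

Fact ptriv_subproof i : walk (i, [::] : seq (arr Q)).1 (i, [::]).2.
Proof. by []. Qed.
Definition ptriv i : qpath Q := exist _ (i, [::]) (ptriv_subproof i).

Fact parrow_subproof a : walk (src a, [:: a]).1 (src a, [:: a]).2.
Proof. by rewrite /= eqxx. Qed.
Definition parrow a : qpath Q := exist _ (src a, [:: a]) (parrow_subproof a).

(* [insub] always succeeds here, see [pcompE]; [None] stands for a zero product *)
Definition pcomp p q : option (qpath Q) :=
  if ptgt p == psrc q then (insub (psrc p, parrs p ++ parrs q) : option (qpath Q)) else None.

Lemma walk_cat i s t :
  walk (Q := Q) i (s ++ t) = walk i s && walk (last i (map (@tgt Q) s)) t.
Proof. by elim: s i => //= a s IH i; rewrite IH andbA. Qed.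

Variant pcomp_spec p q : option (qpath Q) -> Prop :=
| PcompSome r of ptgt p = psrc q & psrc r = psrc p & ptgt r = ptgt q
    & parrs r = parrs p ++ parrs q : pcomp_spec p q (Some r)
| PcompNone of ptgt p != psrc q : pcomp_spec p q None.

Lemma pcompE p q : pcomp_spec p q (pcomp p q).
Proof.
rewrite /pcomp; case: eqP => [e|/eqP]; last by constructor.
case: insubP => [r _ vr|].
  constructor => //; rewrite ?/psrc ?/parrs ?vr //=.
  by move: e; rewrite /ptgt /psrc /parrs vr /= map_cat last_cat => ->.
by rewrite /= walk_cat (valP p) /= -/(ptgt p) e (valP q).
Qed.

Lemma qpathP p q : psrc p = psrc q -> parrs p = parrs q -> p = q.
Proof.
rewrite /psrc /parrs => e1 e2; apply: val_inj.
by rewrite (surjective_pairing (val p)) e1 e2 -surjective_pairing.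
Qed.

End Paths.

Definition pathalg (k : fieldType) (Q : quiver) := {malg k[qpath Q]}.
HB.instance Definition _ k Q := GRing.Lmodule.on (pathalg k Q).

HB.lock Definition path_elt (k : fieldType) (Q : quiver) (p : qpath Q) :
  pathalg k Q := << p >>.

Section LinearExtension.
Variables (k : fieldType) (Q : quiver).
Local Notation A := (pathalg k Q).
Local Notation path_elt := (@path_elt k Q).

Lemma coeff_path_elt p q : (path_elt p)@_q = (p == q)%:R.
Proof. by rewrite unlock mcoeffU mulrb. Qed.

Lemma pathalgE (f : A) : f = \sum_(p <- msupp f) f@_p *: path_elt p.
Proof.
rewrite {1}(monalgE f); apply: eq_bigr => p _.
by rewrite unlock; exact: malg_scaleU.
Qed.

Lemma pathalg_ind (P : A -> Prop) :
  P 0 -> (forall c p f, P f -> P (c *: path_elt p + f)) -> forall f, P f.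
Proof.
move=> P0 PS f; rewrite (pathalgE f); elim: (enum_fset _) => [|p s IH].
  by rewrite big_nil.
by rewrite big_cons; apply: PS.
Qed.

Variable V : lmodType k.
Implicit Types (h : qpath Q -> V) (f g : A).

Definition linext h f : V := \sum_(p <- msupp f) f@_p *: h p.

Lemma linextw h f (d : {fset qpath Q}) : (msupp f `<=` d)%fset ->
  linext h f = \sum_(p <- d) f@_p *: h p.
Proof.
move=> sd; rewrite /linext; apply: big_fset_incl => // p _.
by move=> /mcoeff_outdom->; rewrite scale0r.
Qed.

Fact linext_is_linear h : linear (linext h).
Proof.
move=> c f g; pose d := (msupp f `|` msupp g)%fset.
rewrite (@linextw h f d) ?fsubsetUl // (@linextw h g d) ?fsubsetUr //.
rewrite (@linextw h _ d); last first.
  apply: (fsubset_trans (msuppD_le _ _)).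
  by rewrite fsetSU // msuppZ_le.
rewrite scaler_sumr -big_split /=; apply: eq_bigr => p _.
by rewrite mcoeffD mcoeffZ scalerDl scalerA.
Qed.
HB.instance Definition _ h :=
  GRing.isLinear.Build k A V *:%R (linext h) (linext_is_linear h).

Lemma linextU h p : linext h (path_elt p) = h p.
Proof.
have -> : linext h (path_elt p) = \sum_(q <- [fset p]%fset) (path_elt p)@_q *: h q.
  by apply: linextw; rewrite path_elt.unlock msuppU_le.
by rewrite big_seq_fset1 coeff_path_elt eqxx scale1r.
Qed.

Lemma linext_fun c h h' f :
  linext (fun p => c *: h p + h' p) f = c *: linext h f + linext h' f.
Proof.
rewrite /linext scaler_sumr -big_split /=; apply: eq_bigr => p _.
by rewrite scalerDr !scalerA mulrC.
Qed.

Lemma linext_ext h h' f : h =1 h' -> linext h f = linext h' f.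
Proof. by move=> e; apply: eq_bigr => p _; rewrite e. Qed.

End LinearExtension.

Section Bilinear.
Variables (k : fieldType) (V : lmodType k) (K : Type) (u : K -> V).
Hypothesis V_ind : forall P : V -> Prop,
  P 0 -> (forall c p f, P f -> P (c *: u p + f)) -> forall f, P f.
Variable m : V -> V -> V.
Hypothesis mDl : forall c f g h, m (c *: f + g) h = c *: m f h + m g h.
Hypothesis mDr : forall c f g h, m h (c *: f + g) = c *: m h f + m h g.

Lemma bilin0l h : m 0 h = 0.
Proof. by have := mDl (-1) 0 0 h; rewrite addr0 scaler0 scaleN1r addNr. Qed.

Lemma bilin0r h : m h 0 = 0.
Proof. by have := mDr (-1) 0 0 h; rewrite addr0 scaler0 scaleN1r addNr. Qed.

Lemma bilinZl c f h : c *: m f h = m (c *: f) h.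
Proof. by have := mDl c f 0 h; rewrite bilin0l !addr0. Qed.

Lemma bilinZr c f h : c *: m h f = m h (c *: f).
Proof. by have := mDr c f 0 h; rewrite bilin0r !addr0. Qed.

Lemma bilinDl : left_distributive m +%R.
Proof. by move=> f g h; rewrite -[f]scale1r mDl !scale1r. Qed.

Lemma bilinDr : right_distributive m +%R.
Proof. by move=> h f g; rewrite -[f]scale1r mDr !scale1r. Qed.

Lemma bilin_assoc :
    (forall p q r, m (u p) (m (u q) (u r)) = m (m (u p) (u q)) (u r)) ->
  associative m.
Proof.
move=> mA f g h; elim/V_ind: f => [|c p f IH]; first by rewrite !bilin0l.
rewrite !mDl {}IH; congr (_ *: _ + _).
elim/V_ind: g => [|d q g IH]; first by rewrite !(bilin0l, bilin0r).
rewrite !(mDl, mDr) {}IH; congr (_ *: _ + _).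
elim/V_ind: h => [|e r h IH]; first by rewrite !bilin0r.
by rewrite !mDr {}IH mA.
Qed.

Lemma bilin_left_id e : (forall p, m e (u p) = u p) -> left_id e m.
Proof.
move=> em; elim/V_ind=> [|c p f IH]; first by rewrite bilin0r.
by rewrite mDr IH em.
Qed.

Lemma bilin_right_id e : (forall p, m (u p) e = u p) -> right_id e m.
Proof.
move=> em; elim/V_ind=> [|c p f IH]; first by rewrite bilin0l.
by rewrite mDl IH em.
Qed.

Variables (W : lmodType k) (m' : W -> W -> W) (F : {linear V -> W}).
Hypothesis mDl' : forall c f g h, m' (c *: f + g) h = c *: m' f h + m' g h.
Hypothesis mDr' : forall c f g h, m' h (c *: f + g) = c *: m' h f + m' h g.

Lemma bilin_morph : (forall p q, F (m (u p) (u q)) = m' (F (u p)) (F (u q))) ->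
  {morph F : f g / m f g >-> m' f g}.
Proof.
have m0l h : m' 0 h = 0.
  by have := mDl' (-1) 0 0 h; rewrite addr0 scaler0 scaleN1r addNr.
have m0r h : m' h 0 = 0.
  by have := mDr' (-1) 0 0 h; rewrite addr0 scaler0 scaleN1r addNr.
move=> FU f g; elim/V_ind: f => [|c p f IH].
  by rewrite bilin0l linear0 m0l.
rewrite mDl !linearP mDl' {}IH; congr (_ *: _ + _).
elim/V_ind: g => [|d q g IH]; first by rewrite bilin0r linear0 m0r.
by rewrite mDr !linearP mDr' {}IH FU.
Qed.

End Bilinear.

Definition path_mul (k : fieldType) (Q : quiver) (p q : qpath Q) : pathalg k Q :=
  if pcomp p q is Some r then path_elt k r else 0.

HB.lock Definition pa_mul (k : fieldType) (Q : quiver) (f g : pathalg k Q) :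
  pathalg k Q := linext (fun p => linext (path_mul k p) g) f.

Section PathAlgebra.
Variables (k : fieldType) (Q : quiver).
Implicit Types (f g h : pathalg k Q) (p q r : qpath Q).
Local Notation path_elt := (@path_elt k Q).
Local Notation path_mul := (@path_mul k Q).

Definition pa_one : pathalg k Q := \sum_(i : vert Q) path_elt (ptriv i).

Let mulDl c f g h : pa_mul (c *: f + g) h = c *: pa_mul f h + pa_mul g h.
Proof. by rewrite unlock; exact: linearP. Qed.
Let mulDr c f g h : pa_mul h (c *: f + g) = c *: pa_mul h f + pa_mul h g.
Proof.
have <- : linext (fun p => c *: linext (path_mul p) f + linext (path_mul p) g) h
          = pa_mul h (c *: f + g).
  by rewrite unlock; apply: linext_ext => p; rewrite (linearP (linext (path_mul p))).
by rewrite unlock; exact: linext_fun.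
Qed.
Let mul0l := bilin0l mulDl.
Let mul0r := bilin0r mulDr.
Let mulU p q : pa_mul (path_elt p) (path_elt q) = path_mul p q.
Proof. by rewrite pa_mul.unlock !linextU. Qed.


Fact pa_mulA : associative (@pa_mul k Q).
Proof.
apply: (bilin_assoc (@pathalg_ind k Q) mulDl mulDr) => p q r.
rewrite !mulU /path_mul.
case: (pcompE q r) => [s e1 e2 e3 e4|ne]; case: (pcompE p q) => [t f1 f2 f3 f4|ne'];
  rewrite ?mul0l ?mul0r // ?mulU /path_mul.
- case: pcompE => [u g1 g2 g3 g4|]; last by rewrite e2 f1 eqxx.
  case: pcompE => [w h1 h2 h3 h4|]; last by rewrite f3 e1 eqxx.
  by congr path_elt; apply: qpathP; rewrite ?g2 ?h2 ?f2 // g4 h4 e4 f4 catA.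
- by case: pcompE => // u g1; rewrite g1 e2 eqxx in ne'.
- by case: pcompE => // u g1; rewrite -g1 f3 eqxx in ne.
Qed.

Fact pa_mul1l : left_id pa_one (@pa_mul k Q).
Proof.
apply: (bilin_left_id (@pathalg_ind k Q) mulDr) => p.
rewrite pa_mul.unlock /pa_one linear_sum (bigD1 (psrc p)) //= big1 => [|i ni];
  rewrite !linextU /path_mul.
  rewrite addr0; case: pcompE => [r e1 e2 e3 e4|/eqP[]//].
  by congr path_elt; apply: qpathP.
by case: pcompE => // r e1; rewrite -e1 eqxx in ni.
Qed.

Fact pa_mul1r : right_id pa_one (@pa_mul k Q).
Proof.
apply: (bilin_right_id (@pathalg_ind k Q) mulDl) => p.
rewrite pa_mul.unlock linextU /pa_one linear_sum (bigD1 (ptgt p)) //= big1 => [|i ni];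
  rewrite !linextU /path_mul.
  rewrite addr0; case: pcompE => [r e1 e2 e3 e4|/eqP[]//].
  by congr path_elt; apply: qpathP; rewrite // e4 cats0.
by case: pcompE => // r e1; rewrite e1 eqxx in ni.
Qed.

Fact pa_mulDl : left_distributive (@pa_mul k Q) +%R.
Proof. exact: (bilinDl mulDl). Qed.
Fact pa_mulDr : right_distributive (@pa_mul k Q) +%R.
Proof. exact: (bilinDr mulDr). Qed.

HB.instance Definition _ := GRing.Zmodule_isPzRing.Build (pathalg k Q)
  pa_mulA pa_mul1l pa_mul1r pa_mulDl pa_mulDr.

Lemma pa_scaleAl c f g : c *: (f * g) = (c *: f) * g.
Proof. exact: (bilinZl mulDl). Qed.
Lemma pa_scaleAr c f g : c *: (f * g) = f * (c *: g).
Proof. exact: (bilinZr mulDr). Qed.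
Lemma pa_scale1M c f : (c *: (1 : pathalg k Q)) * f = c *: f.
Proof. by rewrite -pa_scaleAl mul1r. Qed.
Lemma path_eltM p q : path_elt p * path_elt q = path_mul p q.
Proof. exact: mulU. Qed.

Definition idem (i : vert Q) : pathalg k Q := path_elt (ptriv i).
Definition arrow (a : arr Q) : pathalg k Q := path_elt (parrow a).

End PathAlgebra.

Section Modules.
Variables (k : fieldType) (Q : quiver).
Local Notation kQ := (pathalg k Q).

(* k acts on a kQ-module through the structure map k -> kQ *)
Definition kscale (N : lmodType kQ) (c : k) (x : N) : N := (c *: (1 : kQ)) *: x.

Definition findim (N : lmodType kQ) : Prop :=
  exists n (b : 'I_n -> N), forall x, exists c : 'I_n -> k,
    x = \sum_j kscale (c j) (b j).

Record fdmod := FdMod { fdmod_sort :> lmodType kQ; fdmodP : findim fdmod_sort }.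

(* [kdim U n]: the k-subspace U has a basis of n elements *)
Definition kdim (N : lmodType kQ) (U : N -> Prop) (n : nat) : Prop :=
  exists b : 'I_n -> N, (forall j, U (b j)) /\
    forall x, U x -> exists! c : {ffun 'I_n -> k}, x = \sum_j kscale (c j) (b j).

Definition vertex_space (N : lmodType kQ) (i : vert Q) (x : N) : Prop :=
  exists y : N, x = idem k i *: y.

Definition indecomposable (N : fdmod) : Prop :=
  (exists x : N, x <> 0) /\
  forall U V : {pred N}, GRing.submod_closed U -> GRing.submod_closed V ->
    (forall x, exists u v, [/\ u \in U, v \in V & x = u + v]) ->
    (forall x, x \in U -> x \in V -> x = 0) ->
    (forall x, x \in U -> x = 0) \/ (forall x, x \in V -> x = 0).

Definition regular (v : vert Q -> k) : Prop :=
  forall (N : fdmod) (d : vert Q -> nat), indecomposable N ->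
    (forall i, kdim (@vertex_space N i) (d i)) ->
    \sum_i v i * (d i)%:R != 0.

Definition rad (X Y : fdmod) (f : {linear X -> Y}) : Prop :=
  forall (Z : fdmod) (s : {linear Z -> X}) (t : {linear Y -> Z}),
    indecomposable Z -> ~ bijective (t \o f \o s).

Definition rad2 (X Y : fdmod) (f : {linear X -> Y}) : Prop :=
  exists n (W : 'I_n -> fdmod)
         (g : forall j, {linear X -> W j}) (h : forall j, {linear W j -> Y}),
    (forall j, rad (g j) /\ rad (h j)) /\
    forall x, f x = \sum_j h j (g j x).

Definition left_rad2_approx (X Y : fdmod) (f : {linear X -> Y}) : Prop :=
  rad2 f /\
  forall (Z : fdmod) (g : {linear X -> Z}), rad2 g ->
    exists h : {linear Y -> Z}, g =1 h \o f.

Definition minimal_left_rad2_approx (X Y : fdmod) (f : {linear X -> Y}) : Prop :=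
  left_rad2_approx f /\
  forall phi : {linear Y -> Y}, phi \o f =1 f -> bijective phi.

End Modules.

Definition dquiver (Q : quiver) : quiver := {|
  vert := vert Q;
  arr := (arr Q + arr Q)%type;
  src := fun x => match x with inl a => src a | inr a => tgt a end;
  tgt := fun x => match x with inl a => tgt a | inr a => src a end |}.

(* [darr a] is a itself and [dstar a] is a^* *)
Definition darr (Q : quiver) (a : arr Q) : arr (dquiver Q) := inl a.
Definition dstar (Q : quiver) (a : arr Q) : arr (dquiver Q) := inr a.

Section Double.
Variables (k : fieldType) (Q : quiver).
Local Notation kQ := (pathalg k Q).
Local Notation kD := (pathalg k (dquiver Q)).

Lemma walk_inl i s :
  walk (Q := dquiver Q) i (map (@darr Q) s) = walk (Q := Q) i s.
Proof. by elim: s i => //= a s IH i; rewrite IH. Qed.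

Fact pincl_subproof (p : qpath Q) :
  walk (Q := dquiver Q) (psrc p, map (@darr Q) (parrs p)).1
       (psrc p, map (@darr Q) (parrs p)).2.
Proof. by rewrite walk_inl; exact: (valP p). Qed.
Definition pincl (p : qpath Q) : qpath (dquiver Q) :=
  exist _ (psrc p, map (@darr Q) (parrs p)) (pincl_subproof p).

Lemma ptgt_pincl p : ptgt (pincl p) = ptgt p.
Proof. by rewrite /ptgt /= -map_comp. Qed.

Definition incl (f : kQ) : kD := linext (fun p => path_elt k (pincl p)) f.
HB.instance Definition _ := GRing.Linear.copy incl
  (linext (fun p => path_elt k (pincl p)) : {linear kQ -> kD}).

Lemma inclU p : incl (path_elt k p) = path_elt k (pincl p).
Proof. exact: linextU. Qed.

Fact incl_is_monoid_morphism : monoid_morphism incl.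
Proof.
split=> [|f g].
  rewrite [1]/(pa_one _ _) /pa_one linear_sum; apply: eq_bigr => i _.
  by rewrite /= inclU; congr path_elt; apply: qpathP.
move: f g; apply: (@bilin_morph k kQ _ (@path_elt k Q) (@pathalg_ind k Q) *%R _ _
                     kD *%R incl).
- by move=> c f g h; rewrite (mulrDl (c *: f) g h) pa_scaleAl.
- by move=> c f g h; rewrite (mulrDr h (c *: f) g) pa_scaleAr.
- by move=> c f g h; rewrite (mulrDl (c *: f) g h) pa_scaleAl.
- by move=> c f g h; rewrite (mulrDr h (c *: f) g) pa_scaleAr.
move=> p q; rewrite /= path_eltM.
rewrite !inclU path_eltM /path_mul.
case: (pcompE p q) => [r e1 e2 e3 e4|ne]; case: pcompE => [u g1 g2 g3 g4|ne'].
- rewrite inclU; congr path_elt; apply: qpathP; first by rewrite g2.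
  by rewrite g4 /parrs /= -/(parrs r) e4 map_cat.
- by rewrite ptgt_pincl e1 eqxx in ne'.
- by rewrite -ptgt_pincl g1 eqxx in ne.
- exact: linear0.
Qed.
HB.instance Definition _ :=
  GRing.isMonoidMorphism.Build kQ kD incl incl_is_monoid_morphism.

Lemma incl_scale1 c : incl (c *: (1 : kQ)) = c *: (1 : kD).
Proof. by rewrite linearZ /= rmorph1. Qed.

(* deg^*: the number of starred arrows in a path *)
Definition nstar (p : qpath (dquiver Q)) : nat :=
  count (fun a : arr (dquiver Q) => if a is inr _ then true else false) (parrs p).

Definition homog (n : nat) (x : kD) : Prop := forall p, p \in msupp x -> nstar p = n.

(* rho_1 = alpha alpha^*, rho_2 = - alpha^* alpha + beta beta^*,
   rho_3 = - beta^* beta for the quiver 1 -> 2 -> 3 *)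
Definition rho (i : vert Q) : kD :=
  \sum_(a : arr Q | src a == i) arrow k (darr a) * arrow k (dstar a)
  - \sum_(a : arr Q | tgt a == i) arrow k (dstar a) * arrow k (darr a).

Definition vrho (v : vert Q -> k) : kD := \sum_i (v i)^-1 *: rho i.

End Double.

Section TwoSidedIdeal.
Variables (R : pzRingType) (S : R -> Prop).

Definition gideal : {pred R} := fun x => `[< exists l : seq (R * R * R),
  (forall t, t \in l -> S t.1.2) /\ x = \sum_(t <- l) t.1.1 * t.1.2 * t.2 >].

Lemma gidealP x : reflect (exists l : seq (R * R * R),
    (forall t, t \in l -> S t.1.2) /\ x = \sum_(t <- l) t.1.1 * t.1.2 * t.2)
  (x \in gideal).
Proof. exact: asboolP. Qed.

Fact gideal_zmod_closed : zmod_closed gideal.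
Proof.
split=> [|x y /gidealP[l [Sl ->]] /gidealP[l' [Sl' ->]]].
  by apply/gidealP; exists [::]; split => //; rewrite big_nil.
apply/gidealP; exists (l ++ [seq (- t.1.1, t.1.2, t.2) | t <- l']); split.
  by move=> t; rewrite mem_cat => /orP[/Sl//|/mapP[u /Sl' Su ->]].
rewrite big_cat big_map /=; congr (_ + _); rewrite -sumrN.
by apply: eq_bigr => t _; rewrite !mulNr.
Qed.
HB.instance Definition _ := GRing.isZmodClosed.Build R gideal gideal_zmod_closed.

Lemma gidealMl a x : x \in gideal -> a * x \in gideal.
Proof.
move=> /gidealP[l [Sl ->]]; apply/gidealP.
exists [seq (a * t.1.1, t.1.2, t.2) | t <- l]; split.
  by move=> t /mapP[u /Sl Su ->].
by rewrite big_map mulr_sumr; apply: eq_bigr => t _; rewrite !mulrA.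
Qed.

Lemma gidealMr a x : x \in gideal -> x * a \in gideal.
Proof.
move=> /gidealP[l [Sl ->]]; apply/gidealP.
exists [seq (t.1.1, t.1.2, t.2 * a) | t <- l]; split.
  by move=> t /mapP[u /Sl Su ->].
by rewrite big_map mulr_suml; apply: eq_bigr => t _; rewrite !mulrA.
Qed.

Lemma mem_gideal x : S x -> x \in gideal.
Proof.
move=> Sx; apply/gidealP; exists [:: (1, x, 1)]; split.
  by move=> t; rewrite inE => /eqP->.
by rewrite big_seq1 /= mul1r mulr1.
Qed.

Lemma gideal_commDM d r f g : r * d = d * r ->
    f * r - r * f \in gideal -> g * r - r * g \in gideal ->
  (d * f + g) * r - r * (d * f + g) \in gideal.
Proof.
move=> rd hf hg.
have -> : (d * f + g) * r - r * (d * f + g) = d * (f * r - r * f) + (g * r - r * g).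
  by rewrite mulrDl mulrDr opprD addrACA mulrBr !mulrA rd.
by rewrite rpredD // gidealMl.
Qed.

Lemma gideal_commM r f g :
    f * r - r * f \in gideal -> g * r - r * g \in gideal ->
  f * g * r - r * (f * g) \in gideal.
Proof.
move=> hf hg.
have -> : f * g * r - r * (f * g) = f * (g * r - r * g) + (f * r - r * f) * g.
  by rewrite mulrBr mulrBl !mulrA addrA addrNK.
by apply: rpredD; [exact: gidealMl|exact: gidealMr].
Qed.

Definition quot_ring := Quotient.quot gideal.
HB.instance Definition _ := GRing.Zmodule.on quot_ring.
HB.instance Definition _ := EqQuotient.on quot_ring.

Definition qr_one : quot_ring := lift_cst quot_ring 1.
Definition qr_mul := lift_op2 quot_ring *%R.
Canonical pi_qr_one_morph := PiConst qr_one.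

Lemma pi_qr_mul : {morph \pi_(quot_ring) : x y / x * y >-> qr_mul x y}.
Proof.
move=> x y; unlock qr_mul; apply/eqP; rewrite piE Quotient.equivE.
rewrite -[_ * _](addrNK (x * repr (\pi_(quot_ring) y))) -mulrBr.
rewrite -addrA -mulrBl rpredD //.
  by apply: gidealMl; rewrite Quotient.idealrBE [X in _ == X]reprK.
by apply: gidealMr; rewrite Quotient.idealrBE [X in _ == X]reprK.
Qed.
Canonical pi_qr_mul_morph := PiMorph2 pi_qr_mul.

Fact qr_mulA : associative qr_mul.
Proof. by move=> x y z; rewrite -[x]reprK -[y]reprK -[z]reprK !piE mulrA. Qed.
Fact qr_mul1l : left_id qr_one qr_mul.
Proof. by move=> x; rewrite -[x]reprK !piE mul1r. Qed.
Fact qr_mul1r : right_id qr_one qr_mul.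
Proof. by move=> x; rewrite -[x]reprK !piE mulr1. Qed.
Fact qr_mulDl : left_distributive qr_mul +%R.
Proof.
move=> x y z; rewrite -[x]reprK -[y]reprK -[z]reprK.
by apply/eqP; rewrite piE /= mulrDl Quotient.equivE subrr rpred0.
Qed.
Fact qr_mulDr : right_distributive qr_mul +%R.
Proof.
move=> x y z; rewrite -[x]reprK -[y]reprK -[z]reprK.
by apply/eqP; rewrite piE /= mulrDr Quotient.equivE subrr rpred0.
Qed.
HB.instance Definition _ := GRing.Zmodule_isPzRing.Build quot_ring
  qr_mulA qr_mul1l qr_mul1r qr_mulDl qr_mulDr.

Definition qproj (x : R) : quot_ring := \pi_(quot_ring) x.

Fact qproj_is_zmod_morphism : zmod_morphism qproj.
Proof. by move=> x y; rewrite /qproj !piE. Qed.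
HB.instance Definition _ :=
  GRing.isZmodMorphism.Build R quot_ring qproj qproj_is_zmod_morphism.

Fact qproj_is_monoid_morphism : monoid_morphism qproj.
Proof. by split=> [|x y]; rewrite /qproj !piE. Qed.
HB.instance Definition _ :=
  GRing.isMonoidMorphism.Build R quot_ring qproj qproj_is_monoid_morphism.

Lemma qproj_eq x y : qproj x = qproj y <-> x - y \in gideal.
Proof. by rewrite Quotient.idealrBE; split=> [e|/eqP//]; exact/eqP. Qed.

Lemma qproj_surj (y : quot_ring) : exists x, y = qproj x.
Proof. by exists (repr y); rewrite /qproj reprK. Qed.

End TwoSidedIdeal.

Section Homogeneous.
Variables (k : fieldType) (Q : quiver).
Local Notation kQ := (pathalg k Q).
Local Notation kD := (pathalg k (dquiver Q)).
Implicit Types x y : kD.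

Lemma homog0 n : homog n (0 : kD).
Proof. by move=> p; rewrite msupp0 inE. Qed.

Lemma homogD n x y : homog n x -> homog n y -> homog n (x + y).
Proof.
by move=> hx hy p /(fsubsetP (msuppD_le x y)); rewrite inE => /orP[/hx|/hy].
Qed.

Lemma homogN n x : homog n x -> homog n (- x).
Proof. by move=> hx p; rewrite msuppN; apply: hx. Qed.

Lemma homogZ n c x : homog n x -> homog n (c *: x).
Proof. by move=> hx p /(fsubsetP (msuppZ_le c x)); apply: hx. Qed.

Lemma homog_sum n (I : eqType) (r : seq I) (P : pred I) (F : I -> kD) :
  (forall i, i \in r -> P i -> homog n (F i)) -> homog n (\sum_(i <- r | P i) F i).
Proof.
move=> hF; rewrite big_seq_cond; elim/big_ind: _ => [||i /andP[]].
- exact: homog0.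
- exact: homogD.
- exact: hF.
Qed.

Lemma homogU (p : qpath (dquiver Q)) : homog (nstar p) (path_elt k p).
Proof.
by move=> q; rewrite path_elt.unlock => /(fsubsetP msuppU_le); rewrite inE => /eqP->.
Qed.

Lemma homogM m n x y : homog m x -> homog n y -> homog (m + n) (x * y).
Proof.
move=> hx hy; rewrite (pathalgE x) (pathalgE y) mulr_suml.
apply: homog_sum => p px _; rewrite mulr_sumr; apply: homog_sum => q qy _.
rewrite -pa_scaleAl -pa_scaleAr path_eltM /path_mul.
apply/homogZ/homogZ; case: (pcompE p q) => [r _ _ _ e|_]; last exact: homog0.
rewrite -(hx p px) -(hy q qy).
have -> : (nstar p + nstar q)%N = nstar r by rewrite /nstar e count_cat.
exact: homogU.
Qed.

Lemma homog_incl (x : kQ) : homog 0 (incl x).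
Proof.
rewrite /incl /linext; apply: homog_sum => p _ _; apply: homogZ.
have -> : 0%N = nstar (pincl p); last exact: homogU.
rewrite /nstar [parrs _]/(map (@darr Q) (parrs p)) count_map.
by rewrite (eq_count (a2 := pred0)) // count_pred0.
Qed.

Lemma homog_arrow (a : arr (dquiver Q)) :
  homog (if a is inr _ then 1 else 0) (arrow k a).
Proof.
have -> : (if a is inr _ then 1 else 0)%N = nstar (parrow a); last exact: homogU.
by rewrite /nstar; case: a.
Qed.

Lemma homog_vrho v : homog 1 (vrho v : kD).
Proof.
apply: homog_sum => i _ _; apply/homogZ/homogD.
  apply: homog_sum => a _ _.
  exact: (homogM (homog_arrow (a := darr a)) (homog_arrow (a := dstar a))).
apply/homogN/homog_sum => a _ _.
exact: (homogM (homog_arrow (a := dstar a)) (homog_arrow (a := darr a))).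
Qed.

End Homogeneous.

Section PathProducts.
Variables (k : fieldType) (Q : quiver).

Lemma idem_arrow i (a : arr Q) :
  idem k i * arrow k a = (src a == i)%:R *: arrow k a.
Proof.
rewrite path_eltM /path_mul.
case: pcompE => [r e1 e2 _ e3|/negbTE]; last first.
  by rewrite eq_sym /psrc /ptgt /= => ->; rewrite scale0r.
rewrite -[src a]/(psrc (parrow a)) -e1 eqxx scale1r; congr (path_elt k _).
by apply: qpathP; rewrite ?e2 ?e3.
Qed.

Lemma arrow_idem i (a : arr Q) :
  arrow k a * idem k i = (tgt a == i)%:R *: arrow k a.
Proof.
rewrite path_eltM /path_mul.
case: pcompE => [r e1 e2 _ e3|/negbTE]; last first.
  by rewrite /psrc /ptgt /= => ->; rewrite scale0r.
rewrite -[tgt a]/(ptgt (parrow a)) e1 eqxx scale1r; congr (path_elt k _).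
by apply: qpathP; rewrite ?e2 ?e3.
Qed.

Lemma pathalg_gen_ind (P : pathalg k Q -> Prop) :
    P 0 -> (forall c f g, P f -> P g -> P (c *: f + g)) ->
    (forall f g, P f -> P g -> P (f * g)) ->
    (forall i, P (idem k i)) -> (forall a, P (arrow k a)) ->
  forall f, P f.
Proof.
move=> P0 PD PM Pi Pa f; elim/pathalg_ind: f => // c p f Pf; apply: PD => //.
move en : (parrs p) => s; elim: s p en => [|a s IH] p ep.
  have -> : p = ptriv (psrc p) by apply: qpathP.
  exact: Pi.
have := valP p; rewrite -/(psrc p) -/(parrs p) ep /= => /andP[/eqP sa ws].
pose q : qpath Q := exist _ (tgt a, s) ws.
suff -> : path_elt k p = arrow k a * path_elt k q by apply: PM => //; apply: IH.
rewrite path_eltM /path_mul; case: pcompE => [r _ e1 _ e2|/eqP[]//].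
by congr path_elt; apply: qpathP; rewrite ?e1 ?e2 // ep.
Qed.

End PathProducts.

Section Lambda.
Variables (k : fieldType) (Q : quiver) (v : vert Q -> k).
Local Notation kQ := (pathalg k Q).
Local Notation kD := (pathalg k (dquiver Q)).

Definition Lam_rel (x : kD) : Prop :=
  exists a : arr (dquiver Q), x = arrow k a * vrho v - vrho v * arrow k a.

(* ^v Lambda; [Lam_pi] is the projection from the path algebra of the double
   quiver and [Lam_rho] is the class of ^v rho *)
Definition Lam := quot_ring Lam_rel.
HB.instance Definition _ := GRing.PzRing.on Lam.

Definition Lam_pi : kD -> Lam := @qproj kD Lam_rel.
HB.instance Definition _ := GRing.RMorphism.on Lam_pi.

Definition Lam_rho : Lam := Lam_pi (vrho v).

Lemma vrho_idem i : idem k i * vrho v = vrho v * idem k i.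
Proof.
rewrite /vrho mulr_sumr mulr_suml; apply: eq_bigr => j _.
rewrite -pa_scaleAl -pa_scaleAr; congr (_ *: _).
rewrite mulrBl mulrBr; congr (_ - _).
  rewrite mulr_sumr mulr_suml; apply: eq_bigr => a _.
  by rewrite mulrA (@idem_arrow k (dquiver Q)) -[RHS]mulrA
    (@arrow_idem k (dquiver Q)) -pa_scaleAl -pa_scaleAr.
rewrite mulr_sumr mulr_suml; apply: eq_bigr => a _.
by rewrite mulrA (@idem_arrow k (dquiver Q)) -[RHS]mulrA
    (@arrow_idem k (dquiver Q)) -pa_scaleAl -pa_scaleAr.
Qed.

Lemma Lam_rho_central y : Lam_rho * y = y * Lam_rho.
Proof.
have [x ->] := qproj_surj y; rewrite -!/(Lam_pi _) -!rmorphM.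
apply/esym/qproj_eq; elim/(@pathalg_gen_ind k (dquiver Q)): x.
- by rewrite mul0r mulr0 subrr rpred0.
- move=> c f g hf hg; have -> : c *: f = (c *: (1 : kD)) * f.
    by rewrite -pa_scaleAl mul1r.
  by apply: gideal_commDM => //; rewrite -pa_scaleAl -pa_scaleAr mul1r mulr1.
- by move=> f g; apply: gideal_commM.
- by move=> i; rewrite vrho_idem subrr rpred0.
- by move=> a; apply: mem_gideal; exists a.
Qed.

Lemma Lam_rho2_central y : Lam_rho ^+ 2 * y = y * Lam_rho ^+ 2.
Proof. by rewrite expr2 -mulrA !Lam_rho_central mulrA. Qed.

(* kQ acts on ^v Lambda through kQ = ^v Lambda_0 *)
Definition Lam_scale (x : kQ) (y : Lam) : Lam := Lam_pi (incl x) * y.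

Fact Lam_scaleA a b y : Lam_scale a (Lam_scale b y) = Lam_scale (a * b) y.
Proof. by rewrite /Lam_scale !rmorphM mulrA. Qed.
Fact Lam_scale1 : left_id 1 Lam_scale.
Proof. by move=> y; rewrite /Lam_scale !rmorph1 mul1r. Qed.
Fact Lam_scaleDr : right_distributive Lam_scale +%R.
Proof. by move=> a x y; rewrite /Lam_scale mulrDr. Qed.
Fact Lam_scaleDl y : {morph Lam_scale^~ y : a b / a + b}.
Proof. by move=> a b; rewrite /Lam_scale !raddfD mulrDl. Qed.
HB.instance Definition _ := GRing.Zmodule_isLmodule.Build kQ Lam
  Lam_scaleA Lam_scale1 Lam_scaleDr Lam_scaleDl.

Definition Lam_deg (n : nat) (y : Lam) : Prop :=
  exists x : kD, homog n x /\ y = Lam_pi x.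

(* the subset ^v Lambda_n e_i of ^v Lambda *)
Definition Lam_e_pred (n : nat) (i : vert Q) : {pred Lam} :=
  fun y => `[< exists z, Lam_deg n z /\ y = z * Lam_pi (idem k (i : vert (dquiver Q))) >].

Fact Lam_e_submod_closed n i : submod_closed (Lam_e_pred n i).
Proof.
split=> [|a x y /asboolP[_ [[x' [hx ->]] ->]] /asboolP[_ [[y' [hy ->]] ->]]].
  apply/asboolP; exists 0; split; last by rewrite mul0r.
  by exists 0; split; [exact: homog0|rewrite rmorph0].
apply/asboolP; exists (Lam_pi (incl a * x' + y')); split.
  exists (incl a * x' + y'); split=> //; apply: homogD => //.
  exact: (homogM (@homog_incl k Q a) hx).
by rewrite rmorphD rmorphM mulrDl -mulrA.
Qed.
HB.instance Definition _ n i :=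
  GRing.isSubmodClosed.Build kQ Lam (Lam_e_pred n i) (Lam_e_submod_closed n i).

Definition Lam_e (n : nat) (i : vert Q) := {y : Lam | y \in Lam_e_pred n i}.
HB.instance Definition _ n i := SubChoice.on (Lam_e n i).
HB.instance Definition _ n i :=
  [SubChoice_isSubLmodule of Lam_e n i by <:].

Fact rho2_subproof i (y : Lam_e 0 i) : Lam_rho ^+ 2 * val y \in Lam_e_pred 2 i.
Proof.
have /asboolP[_ [[x [hx ->]] e]] := valP y.
apply/asboolP; exists (Lam_pi (vrho v ^+ 2 * x)); split.
  exists (vrho v ^+ 2 * x); split=> //.
  exact: (homogM (homogM (@homog_vrho k Q v) (@homog_vrho k Q v)) hx).
by rewrite [val y]e rmorphM rmorphXn mulrA.
Qed.

(* left multiplication by (^v rho)^2 on ^v Lambda_0 e_i *)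
Definition rho2 i (y : Lam_e 0 i) : Lam_e 2 i :=
  Sub (Lam_rho ^+ 2 * val y) (rho2_subproof y).

Fact rho2_is_linear i : linear (@rho2 i).
Proof.
move=> a x y; apply: val_inj; rewrite /= mulrDr; congr (_ + _).
change (Lam_rho ^+ 2 * (Lam_pi (incl a) * val x) =
        Lam_pi (incl a) * (Lam_rho ^+ 2 * val x)).
by rewrite mulrA Lam_rho2_central mulrA.
Qed.
HB.instance Definition _ i :=
  GRing.isLinear.Build kQ (Lam_e 0 i) (Lam_e 2 i) *:%R (@rho2 i) (@rho2_is_linear i).

End Lambda.

Section LambdaFinDim.
Variables (k : fieldType) (Q : quiver) (v : vert Q -> k).
Local Notation kQ := (pathalg k Q).
Local Notation D := (dquiver Q).

Lemma kscaleA (N : lmodType kQ) c d (x : N) : kscale c (kscale d x) = kscale (c * d) x.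
Proof.
have e : (c *: (1 : kQ) : kQ) * (d *: (1 : kQ) : kQ) = (c * d) *: (1 : kQ).
  by rewrite pa_scale1M; exact: scalerA.
by rewrite /kscale -e; exact: scalerA.
Qed.

Lemma findim_fin (N : lmodType kQ) (I : finType) (b : I -> N) :
  (forall x, exists c : I -> k, x = \sum_z kscale (c z) (b z)) -> findim N.
Proof.
move=> sp; exists #|I|, (fun j => b (enum_val j)) => x.
have [c ->] := sp x; exists (fun j => c (enum_val j)).
exact: (big_enum_val (A := I) (fun z => kscale (c z) (b z))).
Qed.

Lemma val_kscale n i c (y : Lam_e v n i) :
  val (kscale c y) = Lam_pi v (incl (c *: (1 : kQ))) * val y.
Proof. by []. Qed.

Lemma Lam_pi_scale c f (z : Lam v) :
  Lam_pi v (c *: f) * z = Lam_pi v (incl (c *: (1 : kQ))) * (Lam_pi v f * z).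
Proof.
rewrite (mulrA (Lam_pi v _) (Lam_pi v f) z); congr (_ * _).
by rewrite incl_scale1 -rmorphM; congr (Lam_pi v _); rewrite pa_scale1M.
Qed.

Lemma Lam_e_findim n i L :
    (forall p : qpath D, nstar p = n -> size (parrs p) <= L)%N ->
  findim (Lam_e v n i : lmodType kQ).
Proof.
move=> hL; pose I : finType := (vert Q * L.-bseq (arr D))%type.
pose yp (p : qpath D) : Lam_e v n i :=
  insubd 0 (Lam_pi v (path_elt k p) * Lam_pi v (idem k (i : vert D))).
have ypE p : nstar p = n ->
    val (yp p) = Lam_pi v (path_elt k p) * Lam_pi v (idem k (i : vert D)).
  move=> np; apply: insubdK; apply/asboolP; exists (Lam_pi v (path_elt k p)).
  split=> //; exists (path_elt k p); split=> //; rewrite -np; exact: homogU.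
pose b (z : I) : Lam_e v n i :=
  if (insub (z.1, val z.2) : option (qpath D)) is Some p then yp p else 0.
pose Sp (y : Lam_e v n i) := exists c : I -> k, y = \sum_z kscale (c z) (b z).
have Sp0 : Sp 0.
  by exists (fun=> 0); rewrite big1 // => z _; rewrite /kscale !scale0r.
have SpD y y' : Sp y -> Sp y' -> Sp (y + y').
  move=> [c ->] [c' ->]; exists (fun z => c z + c' z); rewrite -big_split /=.
  by apply: eq_bigr => z _; rewrite /kscale !scalerDl.
have SpZ d y : Sp y -> Sp (kscale d y).
  move=> [c ->]; exists (fun z => d * c z); rewrite {1}/kscale scaler_sumr.
  by apply: eq_bigr => z _; rewrite -[LHS]/(kscale _ _) kscaleA.
have Spb z : Sp (b z).
  exists (fun z' => (z' == z)%:R); rewrite (bigD1 z) //= eqxx big1 => [|z' /negbTE->].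
    by rewrite addr0 /kscale !scale1r.
  by rewrite /kscale !scale0r.
have Spy p : nstar p = n -> Sp (yp p).
  move=> /hL sp; suff -> : yp p = b (psrc p, Bseq sp) by [].
  rewrite /b /=; have -> : (psrc p, parrs p) = val p by exact/esym/surjective_pairing.
  by rewrite valK.
apply: (findim_fin (b := b)) => y.
have /asboolP[_ [[x [hx ->]] ey]] := valP y.
suff -> : y = \sum_(p <- msupp x) kscale x@_p (yp p).
  rewrite -/(Sp _) big_seq; apply: big_ind => // p px.
  by apply/SpZ/Spy/hx.
apply: val_inj; rewrite ey (raddf_sum \val) {1}(pathalgE x) raddf_sum mulr_suml.
rewrite big_seq [RHS]big_seq; apply: eq_bigr => p px.
transitivity (Lam_pi v (incl (x@_p *: (1 : kQ))) * val (yp p)); last by [].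
rewrite (ypE _ (hx p px)); exact: Lam_pi_scale.
Qed.

End LambdaFinDim.

Definition A3 : quiver := {|
  vert := 'I_3;
  arr := 'I_2;
  src := widen_ord (leqnSn 2);
  tgt := lift ord0 |}.

(* vertex i of the quiver 1 -> 2 -> 3 is the ordinal i - 1 *)
Definition vtx1 : vert A3 := @Ordinal 3 0 isT.
Definition vtx2 : vert A3 := @Ordinal 3 1 isT.
Definition vtx3 : vert A3 := @Ordinal 3 2 isT.

Lemma walk_A3 (i : vert A3) (s : seq (arr (dquiver A3))) :
    walk (Q := dquiver A3) i s ->
  ((last i (map (@tgt (dquiver A3)) s) : 'I_3) +
     count (fun a : arr (dquiver A3) => if a is inr _ then true else false) s =
   (i : 'I_3) + count (fun a : arr (dquiver A3) => if a is inr _ then false else true) s)%N.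
Proof.
elim: s i => //= -[] a s IH i /andP[/eqP<- /IH] /=.
  by rewrite /bump /= => e; lia.
by rewrite /bump /= => e; lia.
Qed.

Lemma A3_size (n : nat) (p : qpath (dquiver A3)) :
  nstar p = n -> (size (parrs p) <= n + n + 2)%N.
Proof.
move=> np; have := walk_A3 (valP p); rewrite -/(parrs p) -/(nstar p) np.
set a : arr (dquiver A3) -> bool := fun a => if a is inr _ then true else false.
set b : arr (dquiver A3) -> bool := fun a => if a is inr _ then false else true.
have -> : size (parrs p) = (n + count b (parrs p))%N.
  by rewrite -np -(count_predC a) /nstar; congr (_ + _)%N; apply: eq_count => -[].
have : ((last (psrc p) (map (@tgt (dquiver A3)) (parrs p)) : 'I_3) <= 2)%N.
  exact: leq_ord.
move: (nat_of_ord _) (count b _) => x c.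
move: (nat_of_ord _) => y; lia.
Qed.

Definition Lam_mod (k : fieldType) (v : vert A3 -> k) n i : fdmod k A3 :=
  FdMod (Lam_e_findim v i (@A3_size n)).

(* Main.v *)
(* Left modules are representations N3 -beta-> N2 -alpha-> N1.  A product of two
   radical maps from P2 sends e_2 into the image of beta and into the kernel of
   alpha: the indecomposable modules P3 (injective) and S2 detect this through
   the retractions that would otherwise exist.  So the minimal left
   rad^2-approximation of P2 is its unique (up to scalar) nonzero map to the
   interval module I with support {2, 3}, and any map P2 -> I is one exactly
   when it is nonzero.

   With x = alpha^* alpha, y = beta beta^* and u_i = 1 / v_i, the relations give
   x y = y x = b y^2 and x^2 = r y^2, where u_2 b = u_2 + u_3 and
   (u_1 + u_2) r = u_2 b; since v_1 + v_2 + v_3 <> 0 they also give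
   alpha y^2 = 0.  Hence Lambda_2 e_2 has basis beta^* y, y^2 and is isomorphic
   to I, while rho^2 e_2 = u_2^2 (y - x)^2 = u_2^2 (1 - 2 b + r) y^2, whose
   coefficient is a nonzero multiple of v_1 + 2 v_2 + v_3. *)
From HB Require Import structures.
From mathcomp Require Import all_boot all_algebra zify ring.
From mathcomp Require Import boolp.
Require Import Defs.

Set Implicit Arguments.
Unset Strict Implicit.
Unset Printing Implicit Defensive.

Import GRing.Theory.
Local Open Scope ring_scope.

(** * Scalars, homomorphisms and functionals for modules over a path algebra *)

Section KScale.
Variables (k : fieldType) (Q : quiver).
Local Notation kQ := (pathalg k Q).
Implicit Types (N : lmodType kQ) (c d : k).

Lemma kscaleDr N c (x y : N) : kscale c (x + y) = kscale c x + kscale c y.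
Proof. exact: scalerDr. Qed.

Lemma kscaleDl N c d (x : N) : kscale (c + d) x = kscale c x + kscale d x.
Proof. by rewrite /kscale -scalerDl; congr (_ *: _); exact: scalerDl. Qed.

Lemma kscale0r N c : kscale c (0 : N) = 0.
Proof. exact: scaler0. Qed.

Lemma kscale0l N (x : N) : kscale 0 x = 0.
Proof. by rewrite -(scale0r x); congr (_ *: _); exact: scale0r. Qed.

Lemma kscale1 N (x : N) : kscale 1 x = x.
Proof. by rewrite -[RHS]scale1r; congr (_ *: _); exact: scale1r. Qed.

Lemma kscaleN N c (x : N) : kscale (- c) x = - kscale c x.
Proof. by apply/eqP; rewrite -addr_eq0 -kscaleDl addNr kscale0l. Qed.

Lemma kscale_inj N c (x : N) : c != 0 -> kscale c x = 0 -> x = 0.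
Proof.
by move=> c0 e; rewrite -[x]kscale1 -(mulVf c0) -kscaleA e kscale0r.
Qed.

Lemma kscale_eq0 N c (x : N) : x <> 0 -> kscale c x = 0 -> c = 0.
Proof. by move=> x0 e; apply/eqP/negPn/negP => /kscale_inj /(_ e). Qed.

Lemma scale_kscale N (a : kQ) c (x : N) : a *: kscale c x = kscale c (a *: x).
Proof.
have e : a * (c *: (1 : kQ) : kQ) = (c *: (1 : kQ) : kQ) * a.
  by rewrite pa_scale1M -pa_scaleAr mulr1.
transitivity ((a * (c *: (1 : kQ) : kQ)) *: x); first exact: scalerA.
by rewrite e; exact/esym/scalerA.
Qed.

Lemma scale_kscalel N (a : kQ) c (x : N) : (c *: a : kQ) *: x = kscale c (a *: x).
Proof. by rewrite -[c *: a]pa_scale1M; exact/esym/scalerA. Qed.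

Lemma scale_comb N (a : kQ) c d (x : N) :
  (c *: (1 : kQ) + d *: a : kQ) *: x = kscale c x + kscale d (a *: x).
Proof. by rewrite -(scale_kscalel a d x); exact: scalerDl. Qed.

Lemma linear_kscale N (M : lmodType kQ) (f : {linear N -> M}) c (x : N) :
  f (kscale c x) = kscale c (f x).
Proof. exact: linearZ. Qed.

(** Idempotents and arrows generate [kQ], so a k-subspace stable under them is a submodule; this
    yields explicit spanning sets of cyclic modules. *)
Lemma pathalg_stable N (U : N -> Prop) : U 0 ->
    (forall c x y, U x -> U y -> U (kscale c x + y)) ->
    (forall i x, U x -> U (idem k i *: x)) ->
    (forall a x, U x -> U (arrow k a *: x)) ->
  forall (a : kQ) x, U x -> U (a *: x).
Proof.
move=> U0 UD Ui Ua; elim/pathalg_gen_ind => [x _|c f g hf hg x Ux|f g hf hg x Ux|i|a].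
- by rewrite scale0r.
- by rewrite scalerDl scale_kscalel; apply: UD; [apply: hf|apply: hg].
- by rewrite -scalerA; apply/hf/hg.
- exact: Ui.
- exact: Ua.
Qed.

Lemma linear_of_generators N (M : lmodType kQ) (F : N -> M) :
    (forall c x y, F (kscale c x + y) = kscale c (F x) + F y) ->
    (forall i x, F (idem k i *: x) = idem k i *: F x) ->
    (forall a x, F (arrow k a *: x) = arrow k a *: F x) ->
  exists f : {linear N -> M}, f =1 F.
Proof.
move=> FD Fi Fa.
have F0 : F 0 = 0.
  by have := FD (-1) 0 0; rewrite kscale0r addr0 kscaleN kscale1 addNr.
have FZ : forall (a : kQ) x, F (a *: x) = a *: F x.
  elim/pathalg_gen_ind => [x|c f g hf hg x|f g hf hg x|i|a] //.
  - by rewrite !scale0r.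
  - by rewrite !scalerDl !scale_kscalel FD hf hg.
  - by rewrite -!scalerA hf hg.
have Fl : linear F.
  by move=> a x y; rewrite -{1}(kscale1 (a *: x)) FD kscale1 FZ.
pose m := GRing.isLinear.Build kQ N M *:%R F Fl.
by exists (HB.pack_for {linear N -> M} F m).
Qed.

(** With chosen coefficients [z = g z *: x], the map is [z |-> g z *: y]; the inclusion of
    annihilators makes it independent of the choice, hence linear. *)
Lemma cyclic_map N (M : lmodType kQ) (x : N) (y : M) :
    (forall z, exists a : kQ, z = a *: x) ->
    (forall a : kQ, a *: x = 0 -> a *: y = 0) ->
  exists f : {linear N -> M}, f x = y.
Proof.
move=> /choice[g gE] ann.
have wd a b : a *: x = b *: x -> a *: y = b *: y.
  by move=> e; apply/subr0_eq; rewrite -scalerBl ann // scalerBl e subrr.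
have Fl : linear (fun z => g z *: y).
  by move=> a z z'; rewrite scalerA -scalerDl; apply: wd; rewrite scalerDl -scalerA -!gE.
pose m := GRing.isLinear.Build kQ N M *:%R (fun z => g z *: y) Fl.
exists (HB.pack_for {linear N -> M} (fun z => g z *: y) m) => /=.
by rewrite -[RHS]scale1r; apply: wd; rewrite -gE scale1r.
Qed.

(* Enlarge [U] by the spanning vectors one at a time as long as it avoids
   [x0]; the result is a complement of the line through [x0]. *)
Lemma separating_functional N (U : N -> Prop) (x0 : N) : findim N -> U 0 ->
    (forall c x y, U x -> U y -> U (kscale c x + y)) -> ~ U x0 ->
  exists l : N -> k, [/\ forall c x y, l (kscale c x + y) = c * l x + l y,
    forall x, U x -> l x = 0 & l x0 = 1].
Proof.
move=> [n [b spanb]] U0 UD nU.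
have [V [V0 VD UV nV Vb]] : exists V : N -> Prop, [/\ V 0,
    forall c x y, V x -> V y -> V (kscale c x + y), forall x, U x -> V x, ~ V x0
  & forall j, j \in enum 'I_n -> exists c, V (kscale c x0 + b j)].
  elim: (enum 'I_n) => [|j s [V [V0 VD UV nV Vb]]]; first by exists U.
  case: (pselect (exists c, V (kscale c (b j) + x0))) => [[c Vc]|nc].
    exists V; split=> // i; rewrite inE => /orP[/eqP->|/Vb//].
    have c0 : c != 0 by apply: contra_notN nV => /eqP c0; rewrite c0 kscale0l add0r in Vc.
    exists c^-1; rewrite addrC -[b j]kscale1 -(mulVf c0) -kscaleA -kscaleDr.
    by have := VD c^-1 _ _ Vc V0; rewrite addr0.
  exists (fun y => exists c, V (kscale c (b j) + y)); split.
  - by exists 0; rewrite addr0 kscale0l.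
  - move=> c x y [d Vx] [d' Vy]; exists (c * d + d').
    by have := VD c _ _ Vx Vy; rewrite kscaleDr kscaleA kscaleDl addrACA.
  - by move=> x /UV Vx; exists 0; rewrite kscale0l add0r.
  - exact: nc.
  - move=> i; rewrite inE => /orP[/eqP->|/Vb[c Vc]].
      by exists 0, (-1); rewrite kscale0l add0r kscaleN kscale1 addNr.
    by exists c, 0; rewrite kscale0l add0r.
have VN x : exists c, V (kscale c x0 + x).
  have [d ->] := spanb x; elim/big_ind: _ => [|y z [c Vc] [c' Vc']|j _].
  - by exists 0; rewrite kscale0l addr0.
  - by exists (c + c'); have := VD 1 _ _ Vc Vc'; rewrite kscale1 kscaleDl addrACA.
  - have [|c Vc] := Vb j; first by rewrite mem_enum.
    by exists (d j * c); have := VD (d j) _ _ Vc V0; rewrite addr0 kscaleDr kscaleA.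
have [l lE] := choice VN.
(* Since [x0] is not in [V], the coefficient that moves [x] into [V] is unique; linearity follows
   from this. *)
have lu x c : V (kscale c x0 + x) -> l x = c.
  move=> Vc; apply/eqP; rewrite -subr_eq0; apply: contra_notT nV => nz.
  have := VD (-1) _ _ Vc (lE x).
  rewrite kscaleN kscale1 opprD addrACA (addNr x) addr0 -kscaleN -kscaleDl addrC => Vd.
  by have := VD (l x - c)^-1 _ _ Vd V0; rewrite addr0 kscaleA mulVf // kscale1.
(* [l x] is what must be added to land in [V], so the coordinate along [x0] is its opposite. *)
exists (fun x => - l x); split=> [c x y|x /UV Vx|].
- rewrite mulrN -opprD; congr (- _); apply: lu.
  by have := VD c _ _ (lE x) (lE y); rewrite kscaleDr kscaleA kscaleDl addrACA.
- by rewrite (@lu x 0) ?oppr0 // kscale0l add0r.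
- by rewrite (@lu x0 (-1)) ?opprK // kscaleN kscale1 addNr.
Qed.

(** The element [s] lies in every nonzero submodule, so two nonzero submodules never meet in 0. *)
Lemma simple_socle_indecomposable (N : fdmod k Q) (s : N) : s <> 0 ->
    (forall x, x <> 0 -> exists a : kQ, a *: x = s) -> indecomposable N.
Proof.
move=> s0 hs; split; first by exists s.
move=> U V [U0 Uc] [V0 Vc] _ UV.
case: (pselect (forall x, x \in U -> x = 0)); first by left.
move=> /existsNP[u] /not_implyP[Uu /hs[a au]].
right=> w Vw; apply: contra_notP s0 => /hs[b bw]; apply: UV.
  by rewrite -au -[_ *: _]addr0; exact: Uc.
by rewrite -bw -[_ *: _]addr0; exact: Vc.
Qed.

End KScale.

(** * Scalars inside the algebra [Lam v] *)

Section LamScale.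
Variables (k : fieldType) (Q : quiver) (v : vert Q -> k).
Implicit Types (c : k) (z w : Lam v) (f : pathalg k (dquiver Q)).

Lemma Lam_kscaleE c z : kscale c z = Lam_pi v (c *: (1 : pathalg k (dquiver Q))) * z.
Proof. by rewrite -incl_scale1. Qed.

Lemma Lam_kscaleAl c z w : kscale c z * w = kscale c (z * w).
Proof. by rewrite !Lam_kscaleE mulrA. Qed.

Lemma Lam_kscaleAr c z w : z * kscale c w = kscale c (z * w).
Proof.
rewrite !Lam_kscaleE !mulrA; congr (_ * _).
have [f ->] := qproj_surj z; rewrite -!/(Lam_pi v _) -!rmorphM.
by congr (Lam_pi v _); rewrite pa_scale1M -pa_scaleAr mulr1.
Qed.

Lemma Lam_pi_kscale c f : Lam_pi v (c *: f) = kscale c (Lam_pi v f).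
Proof. by rewrite Lam_kscaleE -rmorphM pa_scale1M. Qed.

Lemma val_Lam_kscale n i c (y : Lam_e v n i) : val (kscale c y) = kscale c (val y).
Proof. by []. Qed.

Lemma val_Lam_scale n i a (y : Lam_e v n i) : val (a *: y) = Lam_pi v (incl a) * val y.
Proof. by []. Qed.

End LamScale.

(** * Interval modules *)

Section IntervalModules.
Variable k : fieldType.
Local Notation kQ := (pathalg k A3).

Lemma A3_le (p : qpath A3) : ((psrc p : 'I_3) <= (ptgt p : 'I_3))%N.
Proof.
rewrite /ptgt; have := valP p; rewrite -/(psrc p) -/(parrs p).
elim: (parrs p) (psrc p) => //= a s IH i /andP[/eqP<- /IH]; apply: leq_trans.
by rewrite /= /bump /=; lia.
Qed.

Lemma A3_path (i j : vert A3) : ((i : 'I_3) <= (j : 'I_3))%N ->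
  exists p : qpath A3, psrc p = i /\ ptgt p = j.
Proof.
move=> /subnKC; move: ((j : 'I_3) - (i : 'I_3))%N => d; elim: d i => [|d IH] i.
  by rewrite addn0 => /val_inj <-; exists (ptriv i).
move=> e; have jl := ltn_ord j; have id : (i < 2)%N by move: e jl; lia.
pose a : arr A3 := Ordinal id.
have [|q [qs qt]] := IH (tgt a); first by rewrite /= /bump /=; lia.
case: (pcompE (parrow a) q) => [r _ rs rt _|]; last by rewrite qs eqxx.
by exists r; rewrite rs rt qt; split => //; apply: val_inj.
Qed.

Variables m n : nat.
Hypothesis mn3 : (m + n <= 3)%N.

(** On left modules a path acts from the space at its target to the space at its source: this is the
    matrix unit at (source, target), shifted by [m], or 0 if an endpoint lies outside the
    interval. *)
Definition ival_path (p : qpath A3) : 'M[k]_n :=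
  \matrix_(i, j) (((psrc p : 'I_3) == m + i :> nat)%N && ((ptgt p : 'I_3) == m + j :> nat)%N)%:R.

Definition ival_mx (x : kQ) : 'M[k]_n := linext ival_path x.
HB.instance Definition _ := GRing.Linear.copy ival_mx
  (linext ival_path : {linear kQ -> 'M[k]_n}).

Lemma ival_mxU p : ival_mx (path_elt k p) = ival_path p.
Proof. exact: linextU. Qed.

Lemma ival_mx1 : ival_mx 1 = 1%:M.
Proof.
rewrite [1]/(pa_one _ _) /pa_one linear_sum; apply/matrixP => i j.
rewrite summxE mxE; have li : (m + i < 3)%N by have := ltn_ord i; lia.
rewrite (bigD1 (Ordinal li : vert A3)) //= big1 => [|l nl].
  by rewrite ival_mxU mxE /= /ptgt /= eqxx eqn_add2l addr0.
rewrite ival_mxU mxE /=; case: eqP => //= e.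
by case/eqP: nl; apply: val_inj.
Qed.

Lemma ival_mxM : {morph ival_mx : x y / x * y >-> x *m y}.
Proof.
apply: (@bilin_morph k kQ _ (@path_elt k A3) (@pathalg_ind k A3) *%R _ _
          'M[k]_n (@mulmx _ n n n) ival_mx).
- by move=> c f g h; rewrite (mulrDl (c *: f) g h) pa_scaleAl.
- by move=> c f g h; rewrite (mulrDr h (c *: f) g) pa_scaleAr.
- by move=> c f g h; rewrite mulmxDl scalemxAl.
- by move=> c f g h; rewrite mulmxDr scalemxAr.
move=> p q /=; rewrite path_eltM !ival_mxU /path_mul.
case: (pcompE p q) => [r e rs rt _|ne].
  rewrite ival_mxU; apply/matrixP => i j; rewrite !mxE rs rt.
  case: (boolP (((psrc p : 'I_3) == m + i :> nat)%N && ((ptgt q : 'I_3) == m + j :> nat)%N))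
    => [/andP[pi qj]|npq].
    (* Arrows increase vertices, so the middle vertex lies between two vertices of the interval,
       hence inside it; it is the only index contributing to the matrix product. *)
    have pl := A3_le p; have ql := A3_le q; have jn := ltn_ord j.
    have ln : ((ptgt p : 'I_3) - m < n)%N by move: pl ql (eqP pi) (eqP qj); rewrite -e; lia.
    rewrite (bigD1 (Ordinal ln)) //= big1 => [|l nl].
      by rewrite !mxE /= -e pi qj andbT subnKC ?eqxx ?mulr1 ?addr0 //; move: pl (eqP pi); lia.
    rewrite !mxE; have -> : ((ptgt p : 'I_3) == m + l :> nat)%N = false;
      last by rewrite andbF mul0r.
    by apply: contra_neqF nl => /eqP e'; apply: val_inj; rewrite /= e' addKn.
  rewrite big1 // => l _; rewrite !mxE.
  by move: npq; rewrite negb_and => /orP[]/negbTE->; rewrite ?andbF ?(mul0r, mulr0).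
rewrite [LHS]linear0; apply/matrixP => i j; rewrite !mxE big1 // => l _; rewrite !mxE.
case: ((ptgt p : 'I_3) =P m + l :> nat)%N => [pl|]; last by rewrite andbF mul0r.
case: ((psrc q : 'I_3) =P m + l :> nat)%N => [ql|]; last by rewrite mulr0.
by case/eqP: ne; apply: val_inj; exact: (etrans pl (esym ql)).
Qed.

(* the indecomposable representation supported on the vertices
   [m + 1], ..., [m + n] of the quiver 1 -> 2 -> 3 *)
Definition ival (_ : (m + n <= 3)%N) : Type := 'cV[k]_n.
HB.instance Definition _ := GRing.Zmodule.on (ival mn3).

Definition ival_scale (x : kQ) (f : ival mn3) : ival mn3 := ival_mx x *m f.

Fact ival_scaleA a b f : ival_scale a (ival_scale b f) = ival_scale (a * b) f.
Proof. by rewrite /ival_scale ival_mxM mulmxA. Qed.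
Fact ival_scale1 : left_id 1 ival_scale.
Proof. by move=> f; rewrite /ival_scale ival_mx1 mul1mx. Qed.
Fact ival_scaleDr : right_distributive ival_scale +%R.
Proof. by move=> a x y; rewrite /ival_scale mulmxDr. Qed.
Fact ival_scaleDl f : {morph ival_scale^~ f : a b / a + b}.
Proof. by move=> a b; rewrite /ival_scale raddfD mulmxDl. Qed.
HB.instance Definition _ := GRing.Zmodule_isLmodule.Build kQ (ival mn3)
  ival_scaleA ival_scale1 ival_scaleDr ival_scaleDl.

Definition ival_elt (i : 'I_n) : ival mn3 := delta_mx i 0.

Lemma ival_kscale c (f : ival mn3) : kscale c f = c *: (f : 'cV[k]_n).
Proof.
rewrite -[LHS]/(ival_mx (c *: (1 : kQ) : kQ) *m f) linearZ /=.
by rewrite ival_mx1 -scalemxAl mul1mx.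
Qed.

Lemma ival_sum (f : ival mn3) : f = \sum_i kscale ((f : 'cV[k]_n) i 0) (ival_elt i).
Proof.
rewrite [LHS](matrix_sum_delta (f : 'cV[k]_n)); apply: eq_bigr => i _.
by rewrite big_ord1 ival_kscale.
Qed.

Lemma ival_findim : findim (ival mn3).
Proof. by exists n, ival_elt => f; exists (fun i => (f : 'cV[k]_n) i 0); exact: ival_sum. Qed.

Definition ival_mod : fdmod k A3 := FdMod ival_findim.

Lemma ival_path_pick (p : qpath A3) (i j : 'I_n) (f : ival_mod) :
    ((psrc p : 'I_3) = m + i :> nat)%N -> ((ptgt p : 'I_3) = m + j :> nat)%N ->
  path_elt k p *: f = kscale ((f : 'cV[k]_n) j 0) (ival_elt i).
Proof.
move=> pi pj; rewrite ival_kscale -[LHS]/(ival_mx _ *m f) ival_mxU.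
apply/colP => l; rewrite !mxE andbT (bigD1 j) //= big1 => [|l' nl].
  by rewrite !mxE pi pj eqn_add2l eqxx andbT addr0 mulrC [(i == l :> nat)%N]eq_sym.
rewrite !mxE pj eqn_add2l [(j == l' :> nat)%N]eq_sym.
by rewrite (negbTE (nl : (l' != j :> nat)%N)) andbF mul0r.
Qed.

Lemma ival_path_elt (p : qpath A3) (i j : 'I_n) :
    ((psrc p : 'I_3) = m + i :> nat)%N -> ((ptgt p : 'I_3) = m + j :> nat)%N ->
  path_elt k p *: (ival_elt j : ival_mod) = ival_elt i.
Proof. by move=> pi pj; rewrite (ival_path_pick _ pi pj) mxE !eqxx kscale1. Qed.

Lemma ival_path_out (p : qpath A3) (f : ival_mod) :
    (forall i j : 'I_n, ((psrc p : 'I_3) = m + i :> nat)%N ->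
       ((ptgt p : 'I_3) = m + j :> nat)%N -> False) ->
  path_elt k p *: f = 0.
Proof.
move=> out; rewrite -[LHS]/(ival_mx _ *m f) ival_mxU.
have -> : ival_path p = 0; last exact: mul0mx.
by apply/matrixP => i j; rewrite !mxE; case: eqP => //= /out h; case: eqP => // /h.
Qed.

Lemma ival_elt_neq0 i : (ival_elt i : ival_mod) <> 0.
Proof.
by move=> /matrixP/(_ i 0)/eqP; rewrite !mxE !eqxx oner_eq0.
Qed.

(** The socle is the line at the first vertex of the interval: the path from there to a vertex where
    [f] has a nonzero coordinate carries this coordinate onto the socle. *)
Lemma ival_indecomposable : (0 < n)%N -> indecomposable ival_mod.
Proof.
move=> n0; apply: (simple_socle_indecomposable (s := ival_elt (Ordinal n0) : ival_mod)).
  exact: ival_elt_neq0.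
move=> f f0.
have [l fl] : exists l, (f : 'cV[k]_n) l 0 != 0.
  apply: contra_notP f0 => nf; apply/colP => l; rewrite mxE.
  by apply: contrapT => /eqP fl; apply: nf; exists l.
have lm : (m + l < 3)%N by have := ltn_ord l; lia.
have m3 : (m < 3)%N by lia.
have [|p [ps pt]] := @A3_path (Ordinal m3) (Ordinal lm); first exact: leq_addr.
exists (((f : 'cV[k]_n) l 0)^-1 *: path_elt k p); rewrite scale_kscalel.
rewrite (@ival_path_pick p (Ordinal n0) l) ?ps ?pt ?addn0 //.
by rewrite kscaleA mulVf // kscale1.
Qed.

(** The generator sits at the last vertex of the interval, from which paths reach every basis
    vector. Positivity of [n] is stated in the form that builds its index. *)
Lemma ival_cyclic (n0 : (n.-1 < n)%N) (f : ival_mod) :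
  exists a : kQ, f = a *: ival_elt (Ordinal n0).
Proof.
have /choice[p pE] (l : 'I_n) : exists p : qpath A3,
    ((psrc p : 'I_3) = m + l :> nat)%N /\ ((ptgt p : 'I_3) = m + n.-1 :> nat)%N.
  have ln := ltn_ord l; have lm : (m + l < 3)%N by lia.
  have nm : (m + n.-1 < 3)%N by lia.
  have [|p [ps pt]] := @A3_path (Ordinal lm) (Ordinal nm); first by rewrite /=; lia.
  by exists p; rewrite ps pt.
exists (\sum_l (f : 'cV[k]_n) l 0 *: path_elt k (p l)).
rewrite scaler_suml [LHS]ival_sum; apply: eq_bigr => l _.
have [ps pt] := pE l.
by rewrite scale_kscalel (ival_path_pick _ ps (j := Ordinal n0) pt) mxE !eqxx kscale1.
Qed.

(** The boolean is coerced to a dimension, 1 inside the interval and 0 outside. *)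
Lemma ival_kdim (i : vert A3) :
  kdim (@vertex_space k A3 ival_mod i) (m <= (i : 'I_3) < m + n)%N.
Proof.
case: (boolP (m <= (i : 'I_3) < m + n)%N) => [/andP[mi imn]|h].
  have ln : ((i : 'I_3) - m < n)%N by lia.
  have im : ((i : 'I_3) = m + Ordinal ln :> nat)%N by rewrite /=; lia.
  have pick (f : ival_mod) :
      idem k i *: f = kscale ((f : 'cV[k]_n) (Ordinal ln) 0) (ival_elt (Ordinal ln)).
    exact: (@ival_path_pick (ptriv i) _ _ f im im).
  exists (fun=> ival_elt (Ordinal ln)); split.
    move=> _; exists (ival_elt (Ordinal ln)).
    by rewrite pick mxE !eqxx kscale1.
  move=> x [y xy]; exists [ffun=> (y : 'cV[k]_n) (Ordinal ln) 0]; split.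
    by rewrite big_ord1 ffunE xy pick.
  move=> c; rewrite big_ord1 xy pick => e.
  apply/ffunP => z; rewrite ffunE (ord1 z); apply/eqP; rewrite -subr_eq0; apply/eqP.
  apply: (kscale_eq0 (@ival_elt_neq0 (Ordinal ln))).
  by rewrite kscaleDl kscaleN e subrr.
exists (fun=> 0); split=> [[]//|x [y ->]]; exists [ffun=> 0]; split.
  rewrite big_ord0; apply: ival_path_out => a b ia _; have := ltn_ord a.
  by rewrite /psrc /= in ia; move: h ia; lia.
by move=> c _; apply/ffunP => -[].
Qed.

End IntervalModules.

(* A failed unification of two scalings would otherwise unfold them down to
   finitely supported functions. *)
Local Opaque kscale.

Lemma addr3ACA (V : zmodType) (a b c a' b' c' : V) :
  (a + a') + (b + b') + (c + c') = (a + b + c) + (a' + b' + c').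
Proof. by rewrite (addrACA a a') (addrACA (a + b)). Qed.

(** * Actions of idempotents and arrows *)

Section QuiverAction.
Variables (k : fieldType) (Q : quiver) (N : lmodType (pathalg k Q)).
Implicit Types (x : N) (i j : vert Q) (a b : arr Q).

Lemma idem_idemM i j :
  idem k i * idem k j = if j == i then idem k j else 0.
Proof.
rewrite path_eltM /path_mul; case: pcompE => [r e e1 _ e2|/negbTE]; last first.
  by rewrite eq_sym /psrc /ptgt /= => ->.
move: e; rewrite /ptgt /psrc /= => <-; rewrite eqxx; congr path_elt.
by apply: qpathP; rewrite ?e1 ?e2.
Qed.

Lemma idem_scale_idem i j x :
  idem k i *: (idem k j *: x) = if j == i then idem k j *: x else 0.
Proof. by rewrite scalerA idem_idemM; case: eqP => // _; rewrite scale0r. Qed.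

Lemma idem_scale_arrow i a x :
  idem k i *: (arrow k a *: x) = if src a == i then arrow k a *: x else 0.
Proof.
rewrite scalerA idem_arrow; case: eqP => _; rewrite scale_kscalel.
  by rewrite kscale1.
by rewrite kscale0l.
Qed.

Lemma arrow_scale_idem i a x :
  arrow k a *: (idem k i *: x) = if tgt a == i then arrow k a *: x else 0.
Proof.
rewrite scalerA arrow_idem; case: eqP => _; rewrite scale_kscalel.
  by rewrite kscale1.
by rewrite kscale0l.
Qed.

Lemma arrow_scale_arrow0 a b x : tgt a != src b -> arrow k a *: (arrow k b *: x) = 0.
Proof.
move=> ab; have := arrow_scale_idem (src b) a (arrow k b *: x).
by rewrite idem_scale_arrow eqxx (negbTE ab).
Qed.

End QuiverAction.

(** * Representations of the quiver 1 -> 2 -> 3 and maps between them *)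

Section A3Modules.
Variable k : fieldType.
Local Notation kQ := (pathalg k A3).

Definition alpha : arr A3 := @Ordinal 2 0 isT.
Definition beta : arr A3 := @Ordinal 2 1 isT.

Local Notation al := (arrow k alpha).
Local Notation be := (arrow k beta).
Local Notation e1 := (idem k vtx1).
Local Notation e2 := (idem k vtx2).
Local Notation e3 := (idem k vtx3).

Lemma A3_vertP (P : vert A3 -> Prop) : P vtx1 -> P vtx2 -> P vtx3 -> forall i, P i.
Proof.
move=> P1 P2 P3 [[|[|[|//]]] h].
- by rewrite (_ : Ordinal h = vtx1) //; apply: val_inj.
- by rewrite (_ : Ordinal h = vtx2) //; apply: val_inj.
- by rewrite (_ : Ordinal h = vtx3) //; apply: val_inj.
Qed.

Lemma A3_arrP (P : arr A3 -> Prop) : P alpha -> P beta -> forall a, P a.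
Proof.
move=> Pa Pb [[|[|//]] h].
- by rewrite (_ : Ordinal h = alpha) //; apply: val_inj.
- by rewrite (_ : Ordinal h = beta) //; apply: val_inj.
Qed.

Section Actions.
Variable N : lmodType kQ.
Implicit Type x : N.

Lemma al_al x : al *: (al *: x) = 0. Proof. exact: arrow_scale_arrow0. Qed.
Lemma be_al x : be *: (al *: x) = 0. Proof. exact: arrow_scale_arrow0. Qed.
Lemma be_be x : be *: (be *: x) = 0. Proof. exact: arrow_scale_arrow0. Qed.
Lemma e1_al x : e1 *: (al *: x) = al *: x. Proof. by rewrite idem_scale_arrow. Qed.
Lemma e2_al x : e2 *: (al *: x) = 0. Proof. by rewrite idem_scale_arrow. Qed.
Lemma e3_al x : e3 *: (al *: x) = 0. Proof. by rewrite idem_scale_arrow. Qed.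
Lemma e1_be x : e1 *: (be *: x) = 0. Proof. by rewrite idem_scale_arrow. Qed.
Lemma e2_be x : e2 *: (be *: x) = be *: x. Proof. by rewrite idem_scale_arrow. Qed.
Lemma e3_be x : e3 *: (be *: x) = 0. Proof. by rewrite idem_scale_arrow. Qed.
Lemma al_e1 x : al *: (e1 *: x) = 0. Proof. by rewrite arrow_scale_idem. Qed.
Lemma al_e2 x : al *: (e2 *: x) = al *: x. Proof. by rewrite arrow_scale_idem. Qed.
Lemma al_e3 x : al *: (e3 *: x) = 0. Proof. by rewrite arrow_scale_idem. Qed.
Lemma be_e1 x : be *: (e1 *: x) = 0. Proof. by rewrite arrow_scale_idem. Qed.
Lemma be_e2 x : be *: (e2 *: x) = 0. Proof. by rewrite arrow_scale_idem. Qed.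
Lemma be_e3 x : be *: (e3 *: x) = be *: x. Proof. by rewrite arrow_scale_idem. Qed.
Lemma e1_e1 x : e1 *: (e1 *: x) = e1 *: x. Proof. by rewrite idem_scale_idem. Qed.
Lemma e1_e2 x : e1 *: (e2 *: x) = 0. Proof. by rewrite idem_scale_idem. Qed.
Lemma e1_e3 x : e1 *: (e3 *: x) = 0. Proof. by rewrite idem_scale_idem. Qed.
Lemma e2_e1 x : e2 *: (e1 *: x) = 0. Proof. by rewrite idem_scale_idem. Qed.
Lemma e2_e2 x : e2 *: (e2 *: x) = e2 *: x. Proof. by rewrite idem_scale_idem. Qed.
Lemma e2_e3 x : e2 *: (e3 *: x) = 0. Proof. by rewrite idem_scale_idem. Qed.
Lemma e3_e1 x : e3 *: (e1 *: x) = 0. Proof. by rewrite idem_scale_idem. Qed.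
Lemma e3_e2 x : e3 *: (e2 *: x) = 0. Proof. by rewrite idem_scale_idem. Qed.
Lemma e3_e3 x : e3 *: (e3 *: x) = e3 *: x. Proof. by rewrite idem_scale_idem. Qed.
End Actions.

(** All two-letter products of generators except [al *: (be *: x)], the only path of length two;
    rewriting with them leaves only paths. *)
Definition A3_actE :=
  (al_al, be_al, be_be, e1_al, e2_al, e3_al, e1_be, e2_be, e3_be,
   (al_e1, al_e2, al_e3, be_e1, be_e2, be_e3),
   (e1_e1, e1_e2, e1_e3, e2_e1, e2_e2, e2_e3, e3_e1, e3_e2, e3_e3)).

(** Only the trivial path and [alpha] end at vertex 2. *)
Lemma span_at2 (N : lmodType kQ) (x : N) (a : kQ) : e2 *: x = x ->
  exists c d, a *: x = kscale c x + kscale d (al *: x).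
Proof.
move=> ex; pose U (y : N) := exists c d, y = kscale c x + kscale d (al *: x).
rewrite -/(U _); apply: pathalg_stable.
- by exists 0, 0; rewrite !kscale0l addr0.
- move=> c _ _ [d [d' ->]] [f [f' ->]]; exists (c * d + f), (c * d' + f').
  by rewrite !kscaleDl kscaleDr !kscaleA addrACA.
- move=> i _ [c [d ->]]; rewrite scalerDr !scale_kscale -ex.
  elim/A3_vertP: i; rewrite !A3_actE ?kscale0r.
  + by exists 0, d; rewrite ?ex kscale0l.
  + by exists c, 0; rewrite ?ex kscale0l.
  + by exists 0, 0; rewrite !kscale0l.
- move=> a' _ [c [d ->]]; rewrite scalerDr !scale_kscale -ex.
  elim/A3_arrP: a'; rewrite !A3_actE ?kscale0r.
  + by exists 0, c; rewrite ?ex kscale0l addrC.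
  + by exists 0, 0; rewrite !kscale0l.
- by exists 1, 0; rewrite kscale1 kscale0l addr0.
Qed.

(** Three paths end at vertex 3: the trivial one, [beta], and [alpha] followed by [beta]. *)
Lemma span_at3 (N : lmodType kQ) (x : N) (a : kQ) : e3 *: x = x ->
  exists c d e, a *: x = kscale c x + kscale d (be *: x) + kscale e (al *: (be *: x)).
Proof.
move=> ex; pose U (y : N) := exists c d e,
  y = kscale c x + kscale d (be *: x) + kscale e (al *: (be *: x)).
rewrite -/(U _); apply: pathalg_stable.
- by exists 0, 0, 0; rewrite !kscale0l !addr0.
- move=> c _ _ [d [d' [d'' ->]]] [f [f' [f'' ->]]].
  exists (c * d + f), (c * d' + f'), (c * d'' + f'').
  by rewrite !kscaleDl !kscaleDr !kscaleA addrACA (addrACA (kscale (c * d) x)).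
- move=> i _ [c [d [e ->]]]; rewrite !scalerDr !scale_kscale -ex.
  elim/A3_vertP: i; rewrite !A3_actE ?kscale0r.
  + by exists 0, 0, e; rewrite ?ex !kscale0l !add0r.
  + by exists 0, d, 0; rewrite ?ex !kscale0l addr0.
  + by exists c, 0, 0; rewrite ?ex !kscale0l.
- move=> a' _ [c [d [e ->]]]; rewrite !scalerDr !scale_kscale -ex.
  elim/A3_arrP: a'; rewrite !A3_actE ?kscale0r.
  + by exists 0, 0, d; rewrite ?ex !kscale0l !add0r addr0.
  + by exists 0, c, 0; rewrite ?ex !kscale0l !addr0 add0r.
- by exists 1, 0, 0; rewrite kscale1 !kscale0l !addr0.
Qed.

(* The annihilators are compared inside [N * M], where the pair [(x, y)] has
   the same coefficients in both components. *)
Lemma map_at2 (N M : lmodType kQ) (x : N) (y : M) :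
    (forall z, exists a : kQ, z = a *: x) -> e2 *: x = x -> x <> 0 ->
    e2 *: y = y -> al *: x <> 0 \/ al *: y = 0 ->
  exists f : {linear N -> M}, f x = y.
Proof.
move=> gx ex x0 ey xy; apply: cyclic_map => // a ax.
have exy : e2 *: ((x, y) : (N * M)%type) = (x, y) by congr pair.
have [c [d e]] := span_at2 a exy.
have /= xE := congr1 fst e; have /= yE := congr1 snd e.
have {}xE : a *: x = kscale c x + kscale d (al *: x) := xE.
have {}yE : a *: y = kscale c y + kscale d (al *: y) := yE.
rewrite ax in xE; have c0 : c = 0.
  apply: (kscale_eq0 x0); have := congr1 (fun z => e2 *: z) xE.
  by rewrite /= scalerDr !scale_kscale ex !A3_actE kscale0r addr0 scaler0.
rewrite yE c0 kscale0l add0r; case: xy => [ax0|->]; last by rewrite kscale0r.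
by rewrite (kscale_eq0 ax0 (c := d)) ?kscale0l // xE c0 kscale0l add0r.
Qed.

(** [x] generates P3 if [al *: (be *: x)] is nonzero, and the quotient of P3 with support {2, 3}
    otherwise; in the second case [y] must also be killed by the path of length two. *)
Lemma map_at3 (N M : lmodType kQ) (x : N) (y : M) :
    (forall z, exists a : kQ, z = a *: x) -> e3 *: x = x -> be *: x <> 0 ->
    e3 *: y = y -> al *: (be *: x) <> 0 \/ al *: (be *: y) = 0 ->
  exists f : {linear N -> M}, f x = y.
Proof.
move=> gx ex bx0 ey xy; apply: cyclic_map => // a ax.
have x0 : x <> 0 by move=> x0; apply: bx0; rewrite x0 scaler0.
have exy : e3 *: ((x, y) : (N * M)%type) = (x, y) by congr pair.
have [c [d [e E]]] := span_at3 a exy.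
have xE : a *: x = kscale c x + kscale d (be *: x) + kscale e (al *: (be *: x)) := congr1 fst E.
have yE : a *: y = kscale c y + kscale d (be *: y) + kscale e (al *: (be *: y)) := congr1 snd E.
rewrite ax in xE; have c0 : c = 0.
  apply: (kscale_eq0 x0); have := congr1 (fun z => e3 *: z) xE.
  by rewrite /= !scalerDr !scale_kscale ex !A3_actE !kscale0r !addr0 scaler0.
have d0 : d = 0.
  apply: (kscale_eq0 bx0); have := congr1 (fun z => e2 *: z) xE.
  by rewrite /= c0 kscale0l add0r !scalerDr !scale_kscale !A3_actE !kscale0r !addr0 scaler0.
rewrite yE c0 d0 !kscale0l !add0r; case: xy => [ax0|->]; last by rewrite kscale0r.
by rewrite (kscale_eq0 ax0 (c := e)) ?kscale0l // xE c0 d0 !kscale0l !add0r.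
Qed.

(** A functional [l] induces a map to the dual of [e1 kQ], the injective hull of the simple module
    at vertex 1: [u] goes to the sum of [l (p *: u)] times the dual basis vector of [p], over the
    paths [p] starting at 1. If [be *: x = y], this dual basis is sent to [x], [y], [al *: y]; in
    the other case the coefficient of [x] vanishes. *)
Lemma map_by_functional (N M : lmodType kQ) (l : N -> k) (x y : M) :
    (forall c u w, l (kscale c u + w) = c * l u + l w) ->
    e3 *: x = x -> e2 *: y = y ->
    (forall u, l (al *: (be *: u)) = 0) \/ be *: x = y ->
  exists f : {linear N -> M}, forall u, f u =
    kscale (l (al *: (be *: u))) x + kscale (l (al *: u)) y + kscale (l (e1 *: u)) (al *: y).
Proof.
move=> lP ex ey lxy.
have l0 : l 0 = 0.
  by have := lP (-1) 0 0; rewrite kscale0r addr0 mulN1r addNr.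
apply: linear_of_generators.
- move=> c u w; rewrite !scalerDr !scale_kscale !lP !kscaleDl !kscaleDr !kscaleA.
  exact: addr3ACA.
- elim/A3_vertP => u; rewrite -ex -ey; rewrite !(scalerDr, scale_kscale) !A3_actE;
    by rewrite !(scaler0, l0, kscale0r, kscale0l, addr0, add0r).
- elim/A3_arrP => u.
    rewrite -ex -ey !(scalerDr, scale_kscale) !A3_actE.
    by rewrite !(scaler0, l0, kscale0r, kscale0l, addr0, add0r).
  rewrite -{1}ex -ey !(scalerDr, scale_kscale) !A3_actE ey.
  rewrite !(scaler0, l0, kscale0r, kscale0l, addr0, add0r).
  by case: lxy => ->; rewrite ?kscale0l.
Qed.

End A3Modules.

(** * Radical maps and the approximations of P2 *)

Section Rad2Approximation.
Variable k : fieldType.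
Local Notation kQ := (pathalg k A3).
Local Notation al := (arrow k alpha).
Local Notation be := (arrow k beta).
Local Notation e1 := (idem k vtx1).
Local Notation e2 := (idem k vtx2).
Local Notation e3 := (idem k vtx3).
Implicit Types W X Y Z : fdmod k A3.

Definition cyclic_gen (N : lmodType kQ) (x : N) := forall z, exists a : kQ, z = a *: x.

Lemma linear_cyclic_id (N : lmodType kQ) (x : N) (f : {linear N -> N}) :
  cyclic_gen x -> f x = x -> f =1 id.
Proof. by move=> gx fx z; have [a ->] := gx z; rewrite linearZ /= fx. Qed.

(** An endomorphism that fixes a generator is the identity, so [t \o f \o s] would be bijective,
    which [rad f] forbids. *)
Lemma rad_no_retraction X Y (f : {linear X -> Y}) Z (z : Z)
    (s : {linear Z -> X}) (t : {linear Y -> Z}) :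
  rad f -> indecomposable Z -> cyclic_gen z -> t (f (s z)) <> z.
Proof.
move=> rf iZ gz tz; apply: (rf Z s t iZ).
have e : t \o f \o s =1 id := @linear_cyclic_id _ _ (t \o f \o s) gz tz.
by exists id => u; exact: e.
Qed.

Definition P3 : fdmod k A3 := @ival_mod k 0 3 isT.
Definition p3 : P3 := @ival_elt k 0 3 isT (@Ordinal 3 2 isT).

Lemma p3_gen : cyclic_gen p3. Proof. exact: (@ival_cyclic k 0 3 isT isT). Qed.

Lemma e3_p3 : e3 *: p3 = p3.
Proof. exact: (@ival_path_elt k 0 3 isT (ptriv vtx3)). Qed.

Lemma be_p3 : be *: p3 = @ival_elt k 0 3 isT (@Ordinal 3 1 isT).
Proof. exact: (@ival_path_elt k 0 3 isT (parrow beta)). Qed.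

Lemma al_be_p3 : al *: (be *: p3) = @ival_elt k 0 3 isT (@Ordinal 3 0 isT).
Proof. by rewrite be_p3; exact: (@ival_path_elt k 0 3 isT (parrow alpha)). Qed.

Definition S2 : fdmod k A3 := @ival_mod k 1 1 isT.
Definition s2 : S2 := @ival_elt k 1 1 isT (@Ordinal 1 0 isT).

Lemma s2_gen : cyclic_gen s2. Proof. exact: (@ival_cyclic k 1 1 isT isT). Qed.

Lemma e2_s2 : e2 *: s2 = s2.
Proof. exact: (@ival_path_elt k 1 1 isT (ptriv vtx2)). Qed.

Lemma al_s2 (u : S2) : al *: u = 0.
Proof. by apply: (@ival_path_out k 1 1 isT (parrow alpha) u). Qed.

Lemma S2_at2 (u : S2) : e2 *: u = u.
Proof.
have [a ->] := s2_gen u; have [c [d ->]] := span_at2 a e2_s2.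
by rewrite al_s2 kscale0r addr0 scale_kscale e2_s2.
Qed.

(* [P_3] is injective: a map out of it that is nonzero on its socle splits. *)
Lemma rad_al_be W Z (h : {linear W -> Z}) (p : W) :
  rad h -> e3 *: p = p -> al *: (be *: h p) = 0.
Proof.
move=> rh ep; apply: contrapT => nz.
have [||l [lP _ l1]] := separating_functional (U := fun x : Z => x = 0) (fdmodP Z) _ _ nz.
- by [].
- by move=> c x y -> ->; rewrite kscale0r addr0.
have [||s sp] := map_at3 p3_gen e3_p3 _ ep (or_introl _).
- by rewrite be_p3; apply: ival_elt_neq0.
- by rewrite al_be_p3; apply: ival_elt_neq0.
have e2b : e2 *: (be *: p3) = be *: p3 by rewrite e2_be.
(* This map sends [h p] to [p3]: [l] is 1 at [al *: (be *: h p)], and the other two coefficients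
   vanish because [h p] sits at vertex 3. *)
have [t tE] := map_by_functional lP e3_p3 e2b (or_intror (erefl _)).
have l0 : l 0 = 0.
  by have := lP (-1) 0 0; rewrite kscale0r addr0 mulN1r addNr.
apply: (@rad_no_retraction _ _ h P3 p3 s t rh (ival_indecomposable k _ _) p3_gen) => //.
have eh : e3 *: h p = h p by rewrite -linearZ /= ep.
by rewrite sp tE l1 kscale1 -eh !A3_actE l0 !kscale0l !addr0.
Qed.

(** Otherwise a functional that kills the image of [be] and is 1 at [h q] gives a map from [Z] to
    [S2], while [q] gives one from [S2] to [W]; composed with [h] they would fix [s2]. *)
Lemma rad_at2 W Z (h : {linear W -> Z}) (q : W) :
  rad h -> e2 *: q = q -> al *: q = 0 -> exists z : Z, h q = be *: z.
Proof.
move=> rh eq aq; apply: contrapT => nz.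
have [||l [lP lU l1]] :=
    separating_functional (U := fun x : Z => exists z : Z, x = be *: z) (fdmodP Z) _ _ nz.
- by exists 0; rewrite scaler0.
- move=> c _ _ [y ->] [z ->]; exists (kscale c y + z).
  by rewrite scalerDr scale_kscale.
have [s sq] := map_at2 s2_gen e2_s2 (@ival_elt_neq0 k 1 1 isT (@Ordinal 1 0 isT)) eq (or_intror aq).
have l0 : l 0 = 0 by apply: lU; exists 0; rewrite scaler0.
have [|||t tE] := @linear_of_generators k A3 Z S2 (fun u => kscale (l (e2 *: u)) s2).
- by move=> c x y; rewrite scalerDr scale_kscale lP kscaleDl kscaleA.
- by elim/A3_vertP => u; rewrite -e2_s2 !scale_kscale !A3_actE ?l0 ?kscale0r ?kscale0l.
- elim/A3_arrP => u; rewrite -e2_s2 !scale_kscale !A3_actE ?al_s2 ?l0 ?kscale0r ?kscale0l //.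
  by rewrite lU ?kscale0l //; exists u.
apply: (@rad_no_retraction _ _ h S2 s2 s t rh (ival_indecomposable k _ _) s2_gen) => //.
by rewrite sq tE -linearZ /= eq l1 kscale1.
Qed.

Section ApproximationOfP2.
Variables (X Y : fdmod k A3) (x : X) (y : Y) (f : {linear X -> Y}) (c : k).
Hypotheses (gx : cyclic_gen x) (ex : e2 *: x = x) (ax : al *: x <> 0).
Hypotheses (gy : cyclic_gen y) (ey : e3 *: y = y) (by0 : be *: y <> 0).
Hypotheses (aby : al *: (be *: y) = 0) (fx : f x = kscale c (be *: y)).

Let x0 : x <> 0. Proof. by move=> x0; apply: ax; rewrite x0 scaler0. Qed.

(** Every nonzero element is carried to [al *: x]: by a multiple of [al] if its coefficient at [x]
    is nonzero, by a scalar if not. *)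
Lemma P2_indecomposable : indecomposable X.
Proof.
apply: (simple_socle_indecomposable ax) => z z0.
have [a za] := gx z; have [d [d' dE]] := span_at2 a ex; rewrite za dE.
have [d0|nd] := eqVneq d 0.
  have nd' : d' != 0.
    by apply: contra_notN z0 => /eqP d'0; rewrite za dE d0 d'0 !kscale0l addr0.
  exists (d'^-1 *: (1 : kQ)); rewrite scale_kscalel scale1r.
  by rewrite d0 kscale0l add0r kscaleA mulVf // kscale1.
exists (d^-1 *: al); rewrite scale_kscalel scalerDr !scale_kscale al_al kscale0r addr0.
by rewrite kscaleA mulVf // kscale1.
Qed.

(** If [al *: g x] were not of the form [al *: (be *: p)], a functional separating it from such
    elements would give a retraction of [g]. Hence [al] kills the difference [q] of [g x] and
    [be *: p]. *)
Lemma rad_from_P2 W (g : {linear X -> W}) : rad g ->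
  exists p q : W, [/\ g x = be *: p + q, e3 *: p = p, e2 *: q = q & al *: q = 0].
Proof.
move=> rg; pose U (u : W) := exists p : W, e3 *: p = p /\ u = al *: (be *: p).
case: (pselect (U (al *: g x))) => [[p [ep ap]]|nU].
  exists p, (g x - be *: p); split=> //; first by rewrite addrC subrK.
    by rewrite scalerBr e2_be -linearZ /= ex.
  by rewrite scalerBr ap subrr.
have [||l [lP lU l1]] := separating_functional (fdmodP W) _ _ nU.
- by exists 0; rewrite !scaler0.
- move=> d _ _ [p [ep ->]] [q [eq ->]]; exists (kscale d p + q).
  by rewrite !scalerDr !scale_kscale ep eq.
have lab u : l (al *: (be *: u)) = 0.
  by apply: lU; exists (e3 *: u); rewrite !A3_actE.
(* The vector at vertex 3 is taken to be 0, which is allowed because [l] vanishes on the image of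
   the path of length two. *)
have [t tE] := map_by_functional lP (scaler0 _ _ : e3 *: (0 : X) = 0) ex (or_introl lab).
have egx : e2 *: g x = g x by rewrite -linearZ /= ex.
have l0 : l 0 = 0 by have := lab 0; rewrite !scaler0.
case: (@rad_no_retraction _ _ _ _ _ idfun t rg P2_indecomposable gx).
by rewrite /= tE l1 kscale1 kscale0r add0r -egx A3_actE l0 kscale0l addr0.
Qed.

Lemma rad2_from_P2 Z (g : {linear X -> Z}) : rad2 g ->
  exists z : Z, [/\ g x = be *: z, e3 *: z = z & al *: (be *: z) = 0].
Proof.
move=> [n [W [g1 [h [rgh ->]]]]].
elim/big_ind: _ => [|_ _ [u [-> eu au]] [w [-> ew aw]]|j _].
- by exists 0; rewrite !scaler0.
- by exists (u + w); rewrite !scalerDr eu ew au aw addr0.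
have [rg rh] := rgh j.
have [p [q [-> ep eq aq]]] := rad_from_P2 rg.
have [z hz] := rad_at2 rh eq aq.
(* Replacing [z] by [e3 *: z] moves it to vertex 3 without changing [be *: z], which equals [h j q]
   and is therefore killed by [al]. *)
exists (h j p + e3 *: z); split.
- by rewrite linearD linearZ /= scalerDr hz be_e3.
- by rewrite scalerDr e3_e3 -linearZ /= ep.
- rewrite !scalerDr rad_al_be // add0r be_e3 -hz.
  by rewrite -linearZ /= aq linear0.
Qed.

(** [f] factors through [S2] by [x |-> s2 |-> kscale c (be *: y)]. The first factor is radical
    because no nonzero element of [X] at vertex 2 is killed by [al], the second because a map from
    [Y] to a module embedded in [S2] kills [y]. *)
Lemma rad2_P2 : rad2 f.
Proof.
have [s sE] := map_at2 gx ex x0 e2_s2 (or_introl ax).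
have ecy : e2 *: kscale c (be *: y) = kscale c (be *: y).
  by rewrite scale_kscale e2_be.
have acy : al *: kscale c (be *: y) = 0 by rewrite scale_kscale aby kscale0r.
have [t tE] :=
  map_at2 s2_gen e2_s2 (@ival_elt_neq0 k 1 1 isT (@Ordinal 1 0 isT)) ecy (or_intror acy).
exists 1%N, (fun=> S2), (fun=> s), (fun=> t); split; last first.
  move=> z; rewrite big_ord1; have [a ->] := gx z.
  by rewrite !linearZ /= fx sE tE.
move=> _; split=> Z s' t' [[z z0] _] bij.
- have inj_s : injective s' by move=> u w e; apply: (bij_inj bij); rewrite /= e.
  have [i _ ti] := bij.
  have zt : z = t' (s (s' (i z))) by rewrite -[LHS]ti.
  have e2z : e2 *: z = z by rewrite zt -linearZ /= S2_at2.
  have az : al *: z = 0 by rewrite zt -linearZ /= al_s2 linear0.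
  have [a sz] := gx (s' z); have [d [d' dE]] := span_at2 a ex.
  apply: z0; apply: inj_s; rewrite linear0.
  have e2s : e2 *: s' z = s' z by rewrite -linearZ /= e2z.
  have as0 : al *: s' z = 0 by rewrite -linearZ /= az linear0.
  rewrite -e2s sz dE scalerDr !scale_kscale e2_al kscale0r addr0 ex.
  rewrite sz dE scalerDr !scale_kscale al_al kscale0r addr0 in as0.
  by rewrite (kscale_eq0 ax as0) kscale0l.
- have inj_s : injective s' by move=> u w e; apply: (bij_inj bij); rewrite /= e.
  have ty : t' y = 0.
    apply: inj_s; rewrite linear0 -(S2_at2 (s' _)) -linearZ -linearZ -ey /= A3_actE.
    by rewrite !linear0.
  apply: z0; apply: (bij_inj bij); rewrite linear0 /=.
  have [a sz] := s2_gen (s' z); rewrite sz linearZ /= tE linearZ /=.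
  by rewrite linear_kscale linearZ /= ty !(scaler0, kscale0r).
Qed.

Theorem minimal_left_rad2_approx_P2 : minimal_left_rad2_approx f <-> c != 0.
Proof.
split=> [[_ min]|c0].
  apply: contra_notN by0 => /eqP c0.
  have f0 : f =1 (fun=> 0).
    by move=> z; have [a ->] := gx z; rewrite linearZ /= fx c0 kscale0l scaler0.
  (* For [c = 0] the zero endomorphism fixes [f], so minimality would make it injective and [Y]
     zero. *)
  have /bij_inj inj : bijective (\0 : {linear Y -> Y}).
    by apply: min => z; rewrite /= f0.
  exact: inj.
split.
  split=> [|Z g rg]; first exact: rad2_P2.
  have [z [gz ez az]] := rad2_from_P2 rg.
  (* The factorisation sends [y] to this multiple of [z], hence [f x] to [be *: z = g x]. *)
  have ez' : e3 *: kscale c^-1 z = kscale c^-1 z by rewrite scale_kscale ez.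
  have [|h hy] := map_at3 gy ey by0 ez' (or_intror _).
    by rewrite !scale_kscale az kscale0r.
  exists h => u; have [a ->] := gx u; rewrite /= !linearZ /= fx linear_kscale linearZ /= hy.
  by rewrite gz !scale_kscale kscaleA mulfV // kscale1.
move=> phi phif.
suff py : phi y = y by exists id => u; apply: (linear_cyclic_id gy py).
have pby : phi (be *: y) = be *: y.
  have := phif x; rewrite /= fx linear_kscale => e.
  by rewrite -[LHS]kscale1 -[RHS]kscale1 -(mulVf c0) -!kscaleA e.
have [a pa] := gy (phi y); have [d [d' [d'' dE]]] := span_at3 a ey.
(* The space of [Y] at vertex 3 is the line through [y], so [phi] scales [y]; fixing [be *: y] then
   forces the scalar 1. *)
have pd : phi y = kscale d y.
  have e3p : e3 *: phi y = phi y by rewrite -linearZ /= ey.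
  rewrite -e3p pa dE aby kscale0r addr0 scalerDr !scale_kscale e3_be kscale0r addr0.
  by rewrite ey.
suff -> : phi y = kscale 1 y by rewrite kscale1.
have : kscale (d - 1) (be *: y) = 0.
  by rewrite kscaleDl kscaleN kscale1 -scale_kscale -pd -linearZ /= pby subrr.
move=> /(kscale_eq0 by0)/eqP; rewrite subr_eq0 => /eqP d1.
by rewrite -d1.
Qed.

End ApproximationOfP2.
End Rad2Approximation.

(** * Relations of [Lam v] and a functional vanishing on them *)

Lemma sum_ord2 (V : nmodType) (F : 'I_2 -> V) :
  \sum_i F i = F (@Ordinal 2 0 isT) + F (@Ordinal 2 1 isT).
Proof.
by rewrite !big_ord_recl big_ord0 addr0; congr (F _ + F _); apply: val_inj.
Qed.

Lemma sum_ord3 (V : nmodType) (F : 'I_3 -> V) :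
  \sum_i F i = F (@Ordinal 3 0 isT) + F (@Ordinal 3 1 isT) + F (@Ordinal 3 2 isT).
Proof.
rewrite !big_ord_recl big_ord0 addr0 addrA.
by congr (F _ + F _ + F _); apply: val_inj.
Qed.

(* Locked for the same reason as [kscale] is opaque. *)
HB.lock Definition pscale (k : fieldType) (Q : quiver) (c : k) (f : pathalg k Q) :
  pathalg k Q := c *: f.

Section PScale.
Variables (k : fieldType) (Q : quiver).
Implicit Types (c d : k) (f g h : pathalg k Q).

Lemma pscaleE c f : c *: f = pscale c f.
Proof. by rewrite pscale.unlock. Qed.

Lemma pscaleDr c f g : pscale c (f + g) = pscale c f + pscale c g.
Proof. rewrite pscale.unlock; exact: scalerDr. Qed.

Lemma pscaleN c f : pscale c (- f) = - pscale c f.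
Proof. rewrite pscale.unlock; exact: scalerN. Qed.

Lemma pscaleDl c d f : pscale (c + d) f = pscale c f + pscale d f.
Proof. rewrite pscale.unlock; exact: scalerDl. Qed.

Lemma pscale0 c : pscale c 0 = 0 :> pathalg k Q.
Proof. rewrite pscale.unlock; exact: scaler0. Qed.

Lemma pscaleAr c f g : f * pscale c g = pscale c (f * g).
Proof. rewrite pscale.unlock; exact/esym/pa_scaleAr. Qed.

Lemma pscaleAl c f g : pscale c f * g = pscale c (f * g).
Proof. rewrite pscale.unlock; exact/esym/pa_scaleAl. Qed.

End PScale.

Section Lambda2.
Variables (k : fieldType) (v : vert A3 -> k).

Lemma regular_ival (m n : nat) : regular v -> (m + n <= 3)%N -> (0 < n)%N ->
  v vtx1 * (m <= 0 < m + n)%N%:R + v vtx2 * (m <= 1 < m + n)%N%:R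
    + v vtx3 * (m <= 2 < m + n)%N%:R != 0.
Proof.
move=> hv mn n0.
have := hv _ _ (ival_indecomposable k mn n0) (ival_kdim k mn).
by rewrite (sum_ord3 (fun i : 'I_3 => v i * (m <= i < m + n)%N%:R)).
Qed.

(** The dimension vectors of the six interval modules are the positive roots of type A3. *)
Lemma regular_neq0 : regular v ->
  [/\ v vtx1 != 0, v vtx2 != 0, v vtx3 != 0 &
      [/\ v vtx1 + v vtx2 != 0, v vtx2 + v vtx3 != 0 & v vtx1 + v vtx2 + v vtx3 != 0]].
Proof.
move=> hv; have r m n := @regular_ival m n hv; split; last split.
- by have := r 0%N 1%N isT isT; rewrite !(mulr1, mulr0, addr0, add0r).
- by have := r 1%N 1%N isT isT; rewrite !(mulr1, mulr0, addr0, add0r).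
- by have := r 2%N 1%N isT isT; rewrite !(mulr1, mulr0, addr0, add0r).
- by have := r 0%N 2%N isT isT; rewrite !(mulr1, mulr0, addr0, add0r).
- by have := r 1%N 2%N isT isT; rewrite !(mulr1, mulr0, addr0, add0r).
- by have := r 0%N 3%N isT isT; rewrite !(mulr1, mulr0, addr0, add0r).
Qed.

Local Notation D := (dquiver A3).
Local Notation kD := (pathalg k D).
Local Notation al := (arrow k (@darr A3 alpha)).
Local Notation be := (arrow k (@darr A3 beta)).
Local Notation als := (arrow k (@dstar A3 alpha)).
Local Notation bes := (arrow k (@dstar A3 beta)).
Local Notation u1 := (v vtx1)^-1.
Local Notation u2 := (v vtx2)^-1.
Local Notation u3 := (v vtx3)^-1.

Lemma vrhoE : vrho v =
  pscale u1 (al * als) + pscale u2 (be * bes - als * al) - pscale u3 (bes * be) :> kD.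
Proof.
have rhoE (i : vert A3) : rho k i =
    ((if src alpha == i then al * als else 0) + (if src beta == i then be * bes else 0))
    - ((if tgt alpha == i then als * al else 0) + (if tgt beta == i then bes * be else 0)).
  rewrite /rho; congr (_ - _); rewrite big_mkcond.
    exact: (@sum_ord2 kD (fun a : arr A3 =>
      if src a == i then arrow k (darr a) * arrow k (dstar a) else 0)).
  exact: (@sum_ord2 kD (fun a : arr A3 =>
    if tgt a == i then arrow k (dstar a) * arrow k (darr a) else 0)).
have r1 : rho k vtx1 = al * als by rewrite rhoE /= !addr0 subr0.
have r2 : rho k vtx2 = be * bes - als * al by rewrite rhoE /= add0r addr0.
have r3 : rho k vtx3 = - (bes * be) by rewrite rhoE /= !add0r.
transitivity (pscale u1 (rho k vtx1) + pscale u2 (rho k vtx2) + pscale u3 (rho k vtx3)).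
  rewrite pscale.unlock.
  exact: (@sum_ord3 kD (fun i : vert A3 => (v i)^-1 *: rho k i)).
by rewrite r1 r2 r3 pscaleN.
Qed.

Lemma arrow_arrow0 (Q : quiver) (a b : arr Q) : tgt a != src b ->
  arrow k a * arrow k b = 0.
Proof.
move=> ab; rewrite path_eltM /path_mul.
by case: pcompE => // r /eqP; rewrite (negbTE ab).
Qed.

Lemma D_arrow0 : (((al * al)%R = 0) * ((al * bes)%R = 0) * ((be * al)%R = 0) * ((be * be)%R = 0) *
  ((be * als)%R = 0) * ((als * be)%R = 0) * ((als * als)%R = 0) * ((als * bes)%R = 0) *
  (((bes * al)%R = 0) * ((bes * bes)%R = 0)))%type.
Proof. by do !split; apply: arrow_arrow0. Qed.

Lemma mul_vrho (x : kD) : x * vrho v =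
  pscale u1 (x * al * als) + pscale u2 (x * be * bes - x * als * al) - pscale u3 (x * bes * be).
Proof. by rewrite vrhoE mulrBr mulrDr !pscaleAr mulrBr !mulrA. Qed.

Lemma vrho_mul (x : kD) : vrho v * x =
  pscale u1 (al * (als * x)) + pscale u2 (be * (bes * x) - als * (al * x))
  - pscale u3 (bes * (be * x)).
Proof. by rewrite vrhoE mulrBl mulrDl !pscaleAl mulrBl !mulrA. Qed.

(** An arrow multiplied by [vrho v] on the right meets only the summand at its target, and on the
    left only the one at its source; likewise for the next three relations. *)
Lemma rel_al : al * vrho v - vrho v * al =
  pscale u2 (al * be * bes) - pscale (u1 + u2) (al * als * al).
Proof.
rewrite mul_vrho vrho_mul !(D_arrow0, mul0r, mulr0, pscale0, subr0, sub0r, add0r, addr0, oppr0).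
rewrite ?(pscaleDr, pscaleN, pscaleDl) !mulrA. 
by rewrite opprD addrA addrAC.
Qed.

Lemma rel_be : be * vrho v - vrho v * be =
  pscale u2 (als * al * be) - pscale (u2 + u3) (be * bes * be).
Proof.
rewrite mul_vrho vrho_mul !(D_arrow0, mul0r, mulr0, pscale0, subr0, sub0r, add0r, addr0, oppr0).
rewrite ?(pscaleDr, pscaleN, pscaleDl) !mulrA. 
by rewrite opprB addrC -addrA -opprD.
Qed.

Lemma rel_als : als * vrho v - vrho v * als =
  pscale (u1 + u2) (als * al * als) - pscale u2 (be * bes * als).
Proof.
rewrite mul_vrho vrho_mul !(D_arrow0, mul0r, mulr0, pscale0, subr0, sub0r, add0r, addr0, oppr0).
rewrite ?(pscaleDr, pscaleN, pscaleDl) !mulrA. 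
by rewrite opprB addrA.
Qed.

Lemma rel_bes : bes * vrho v - vrho v * bes =
  pscale (u2 + u3) (bes * be * bes) - pscale u2 (bes * als * al).
Proof.
rewrite mul_vrho vrho_mul !(D_arrow0, mul0r, mulr0, pscale0, subr0, sub0r, add0r, addr0, oppr0).
rewrite ?(pscaleDr, pscaleN, pscaleDl) !mulrA. 
by rewrite opprK addrAC.
Qed.

(* The functional on the path algebra of the double quiver that witnesses the
   nonvanishing of the class of [(be bes)^2]: it is supported on the words of
   length 4 in which two letters are starred, from vertex 2 to vertex 2. *)
Section Functional.
Variables b r : k.
Hypotheses (ub : u2 * b = u2 + u3) (ur : (u1 + u2) * r = u2 * b).

(** On its support the value is the coefficient of the word as a multiple of [(be bes)^2] in the
    quotient: 1 for that word itself, [r] for [(als al)^2], [b] for the two mixed products. *)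
Definition word_coef (s : seq (arr D)) : k :=
  match s with
  | [:: inl a1; inr a2; inl a3; inr a4] =>
    if [:: a1; a2; a3; a4] == [:: beta; beta; beta; beta] then 1 else 0
  | [:: inr a1; inl a2; inr a3; inl a4] =>
    if [:: a1; a2; a3; a4] == [:: alpha; alpha; alpha; alpha] then r else 0
  | [:: inl a1; inr a2; inr a3; inl a4] =>
    if [:: a1; a2; a3; a4] == [:: beta; beta; alpha; alpha] then b else 0
  | [:: inr a1; inl a2; inl a3; inr a4] =>
    if [:: a1; a2; a3; a4] == [:: alpha; alpha; beta; beta] then b else 0
  | _ => 0
  end.

Definition word_fun (f : kD) : k^o := linext (fun p => word_coef (parrs p) : k^o) f.
HB.instance Definition _ := GRing.Linear.copy word_fun
  (linext (fun p => word_coef (parrs p) : k^o) : {linear kD -> k^o}).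

Lemma word_funU p : word_fun (path_elt k p) = word_coef (parrs p).
Proof. exact: linextU. Qed.

Lemma word_funZ c f : word_fun (pscale c f) = c * word_fun f.
Proof. by rewrite -pscaleE linearZ. Qed.

Lemma word_coef_size s : size s != 4%N -> word_coef s = 0.
Proof. by case: s => [|[]? [|[]? [|[]? [|[]? []]]]]. Qed.

Lemma word_funM (p w q : qpath D) :
  word_fun (path_elt k p * path_elt k w * path_elt k q) =
  if (ptgt p == psrc w) && (ptgt w == psrc q)
  then word_coef (parrs p ++ parrs w ++ parrs q) else 0.
Proof.
rewrite path_eltM /path_mul; case: (pcompE p w) => [t pw ts tt tp|/negbTE->]; last first.
  by rewrite mul0r linear0.
rewrite pw eqxx path_eltM /path_mul; case: (pcompE t q) => [t' tq _ _ tp'|]; last first.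
  by rewrite tt => /negbTE->; rewrite linear0.
by rewrite -tt tq eqxx word_funU tp' tp catA.
Qed.

Lemma arrow3E (a1 a2 a3 : arr D) : tgt a1 = src a2 -> tgt a2 = src a3 ->
  exists w : qpath D, [/\ arrow k a1 * arrow k a2 * arrow k a3 = path_elt k w,
    parrs w = [:: a1; a2; a3], psrc w = src a1 & ptgt w = tgt a3].
Proof.
move=> a12 a23; rewrite path_eltM /path_mul.
case: pcompE => [t _ ts tt tp|/eqP//]; rewrite path_eltM /path_mul.
case: pcompE => [t' _ ts' tt' tp'|/eqP]; last by rewrite tt.
by exists t'; split; rewrite ?tp' ?tp ?ts' ?ts ?tt'.
Qed.

(** The relation has length 3 and the functional sees only words of length 4, so exactly one letter
    is added, on the left or on the right: hence the last two hypotheses. *)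
Lemma word_fun_rel c c' (a1 a2 a3 a1' a2' a3' : arr D) (f g : kD) :
    tgt a1 = src a2 -> tgt a2 = src a3 -> tgt a1' = src a2' -> tgt a2' = src a3' ->
    src a1 = src a1' -> tgt a3 = tgt a3' ->
    (forall a, c * word_coef [:: a; a1; a2; a3] = c' * word_coef [:: a; a1'; a2'; a3']) ->
    (forall a, c * word_coef [:: a1; a2; a3; a] = c' * word_coef [:: a1'; a2'; a3'; a]) ->
  word_fun (f * (pscale c (arrow k a1 * arrow k a2 * arrow k a3)
                 - pscale c' (arrow k a1' * arrow k a2' * arrow k a3')) * g) = 0.
Proof.
move=> t12 t23 t12' t23' s11 t33 cl cr.
have [w [-> wp ws wt]] := arrow3E t12 t23; have [w' [-> wp' ws' wt']] := arrow3E t12' t23'.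
elim/pathalg_ind: f => [|d p f IH]; first by rewrite !mul0r linear0.
rewrite mulrDl mulrDl linearD /= IH addr0 pscaleE !pscaleAl word_funZ.
elim/pathalg_ind: g {IH} => [|d' q g IHg]; first by rewrite mulr0 linear0 mulr0.
rewrite mulrDr linearD /= mulrDr IHg addr0 pscaleE pscaleAr word_funZ.
rewrite mulrBr mulrBl !(pscaleAr, pscaleAl) linearB /= !word_funZ !word_funM.
rewrite ws ws' wt wt' s11 t33; case: ifP => _; last by rewrite !mulr0 subrr !mulr0.
suff -> : c * word_coef (parrs p ++ parrs w ++ parrs q) =
    c' * word_coef (parrs p ++ parrs w' ++ parrs q) by rewrite subrr !mulr0.
rewrite wp wp'; case: (parrs p) => [|a [|a' s]]; case: (parrs q) => [|e [|e' s']];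
  try by [apply: cl|apply: cr].
all: by rewrite !word_coef_size ?mulr0 //= size_cat /= ?addnS.
Qed.

(** The only nontrivial check is [ur] for the relations of [alpha] and its dual, and [ub] for those
    of [beta] and its dual. *)
Lemma word_fun_ideal (x : kD) : x \in gideal (Lam_rel v) -> word_fun x = 0.
Proof.
move=> /gidealP[l [Sl ->]]; rewrite linear_sum big_seq big1 // => t /Sl[a ->] /=.
case: a => a; elim/A3_arrP: a.
- by rewrite rel_al; apply: word_fun_rel => [||||||[] a|[] a]; do ?exact: val_inj;
    elim/A3_arrP: a => /=; rewrite ?mulr0 ?mulr1.
- by rewrite rel_be; apply: word_fun_rel => [||||||[] a|[] a]; do ?exact: val_inj;
    elim/A3_arrP: a => /=; rewrite ?mulr0 ?mulr1.
- by rewrite rel_als; apply: word_fun_rel => [||||||[] a|[] a]; do ?exact: val_inj;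
    elim/A3_arrP: a => /=; rewrite ?mulr0 ?mulr1.
- by rewrite rel_bes; apply: word_fun_rel => [||||||[] a|[] a]; do ?exact: val_inj;
    elim/A3_arrP: a => /=; rewrite ?mulr0 ?mulr1.
Qed.

End Functional.
End Lambda2.

(** * Spanning sets of [Lam_e v n vtx2] for n at most 2, and the square of rho at vertex 2 *)

Section LambdaSpan.
Variables (k : fieldType) (v : vert A3 -> k).
Local Notation D := (dquiver A3).
Local Notation kD := (pathalg k D).
Local Notation L := (Lam v).
Local Notation al := (arrow k (@darr A3 alpha)).
Local Notation be := (arrow k (@darr A3 beta)).
Local Notation als := (arrow k (@dstar A3 alpha)).
Local Notation bes := (arrow k (@dstar A3 beta)).
Local Notation u1 := (v vtx1)^-1.
Local Notation u2 := (v vtx2)^-1.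
Local Notation u3 := (v vtx3)^-1.
Local Notation A := (Lam_pi v al).
Local Notation B := (Lam_pi v be).
Local Notation A' := (Lam_pi v als).
Local Notation B' := (Lam_pi v bes).
Local Notation E i := (Lam_pi v (idem k (i : vert D))).
Local Notation X := (A' * A).
Local Notation Y := (B * B').
Local Notation W := (Y * Y).
Local Notation T := (B' * Y).

Lemma Lam_pi_pscale c f : Lam_pi v (pscale c f) = kscale c (Lam_pi v f).
Proof. by rewrite -pscaleE Lam_pi_kscale. Qed.

Lemma Lam_rel0 a : Lam_pi v (arrow k a * vrho v - vrho v * arrow k a) = 0.
Proof. by rewrite rmorphB !rmorphM /= -/(Lam_rho v) Lam_rho_central subrr. Qed.

Lemma Lam_al : kscale u2 (A * Y) = kscale (u1 + u2) (A * X).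
Proof.
have := Lam_rel0 (darr alpha); rewrite rel_al rmorphB /= !Lam_pi_pscale !rmorphM /= !mulrA.
by move/eqP; rewrite subr_eq0 => /eqP.
Qed.

Lemma Lam_be : kscale u2 (X * B) = kscale (u2 + u3) (Y * B).
Proof.
have := Lam_rel0 (darr beta); rewrite rel_be rmorphB /= !Lam_pi_pscale !rmorphM /=.
by move/eqP; rewrite subr_eq0 => /eqP.
Qed.

Lemma Lam_bes : kscale (u2 + u3) T = kscale u2 (B' * X).
Proof.
have := Lam_rel0 (dstar beta); rewrite rel_bes rmorphB /= !Lam_pi_pscale !rmorphM /= !mulrA.
by move/eqP; rewrite subr_eq0 => /eqP.
Qed.

Lemma Lam_arrow0 a b : tgt a != src b -> Lam_pi v (arrow k a) * Lam_pi v (arrow k b) = 0.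
Proof. by move=> ab; rewrite -rmorphM arrow_arrow0 // rmorph0. Qed.

Lemma Lam_arrow_idem i (a : arr D) :
  Lam_pi v (arrow k a) * E i = if tgt a == i then Lam_pi v (arrow k a) else 0.
Proof.
rewrite -rmorphM arrow_idem; case: eqP => _; first by rewrite scale1r.
by rewrite scale0r rmorph0.
Qed.

Lemma Lam_idem_arrow i (a : arr D) :
  E i * Lam_pi v (arrow k a) = if src a == i then Lam_pi v (arrow k a) else 0.
Proof.
rewrite -rmorphM idem_arrow; case: eqP => _; first by rewrite scale1r.
by rewrite scale0r rmorph0.
Qed.

Lemma Lam0E : (((A * A)%R = 0) * ((A * B')%R = 0) * ((B * A)%R = 0) * ((B * B)%R = 0) *
  ((B * A')%R = 0) * ((A' * B)%R = 0) * ((A' * A')%R = 0) * ((A' * B')%R = 0) *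
  ((B' * A)%R = 0) * ((B' * B')%R = 0) *
  ((A * E vtx2)%R = A) * ((B * E vtx2)%R = 0) *
  ((A' * E vtx2)%R = 0) * ((B' * E vtx2)%R = B'))%type.
Proof. by do !split; rewrite ?Lam_arrow_idem //; apply: Lam_arrow0. Qed.

Hypotheses (u2n0 : u2 != 0) (u12 : u1 + u2 != 0).
Hypothesis (u123 : u2 * u2 - (u1 + u2) * (u2 + u3) != 0).
Let b := u2^-1 * (u2 + u3).
Let r := (u1 + u2)^-1 * (u2 * b).

Let ub : u2 * b = u2 + u3. Proof. by rewrite /b mulVKf. Qed.
Let ur : (u1 + u2) * r = u2 * b. Proof. by rewrite /r mulVKf. Qed.

Lemma kscale_solve (N : lmodType (pathalg k A3)) c d (x y : N) : c != 0 ->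
  kscale c x = kscale d y -> x = kscale (c^-1 * d) y.
Proof. by move=> c0 e; rewrite -kscaleA -e kscaleA mulVf // kscale1. Qed.

Lemma Lam_AY : A * Y = kscale (u2^-1 * (u1 + u2)) (A * X).
Proof. exact: kscale_solve Lam_al. Qed.

Lemma Lam_BsX : B' * X = kscale b T.
Proof. exact: kscale_solve (esym Lam_bes). Qed.

(** This is the relation of [beta] multiplied by [B'] on the right. *)
Lemma Lam_XY : X * Y = kscale b W.
Proof.
have /(congr1 (fun z : L => z * B')) := Lam_be.
rewrite !Lam_kscaleAl -!mulrA => /(kscale_solve u2n0) e.
exact: e.
Qed.

Lemma Lam_YX : Y * X = kscale b W.
Proof. by rewrite -mulrA Lam_BsX Lam_kscaleAr !mulrA. Qed.

(** The relation of [alpha] multiplied by [A'] on the left, reduced by [Lam_XY]. *)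
Lemma Lam_XX : X * X = kscale r W.
Proof.
have /(congr1 (fun z : L => A' * z)) := esym Lam_al.
rewrite !Lam_kscaleAr (mulrA A' A Y) Lam_XY kscaleA => /(kscale_solve u12) e.
by rewrite -mulrA.
Qed.

(** The relation of [alpha] times [Y] shows that [u2 - (u1 + u2) * b] kills [A * W]; this scalar is
    nonzero because its product with [u2] is the quantity in [u123]. *)
Lemma Lam_AW : A * W = 0.
Proof.
have e : kscale u2 (A * W) = kscale ((u1 + u2) * b) (A * W).
  have /(congr1 (fun z : L => z * Y)) := Lam_al.
  by rewrite !Lam_kscaleAl -(mulrA A Y Y) -(mulrA A X Y) Lam_XY Lam_kscaleAr kscaleA.
apply: (@kscale_inj _ _ _ (u2 - (u1 + u2) * b)); last by rewrite kscaleDl kscaleN e subrr.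
have : u2 * (u2 - (u1 + u2) * b) != 0 by rewrite mulrBr mulrCA ub.
by rewrite mulf_eq0 negb_or => /andP[].
Qed.

Lemma Lam_W_neq0 : W <> 0.
Proof.
rewrite -!rmorphM -(rmorph0 (Lam_pi v)) => /qproj_eq; rewrite subr0 => /(word_fun_ideal ub ur).
have [||w [wE wp _ wt]] := @arrow3E k (darr beta) (dstar beta) (darr beta); try exact: val_inj.
rewrite mulrA wE path_eltM /path_mul.
case: (pcompE w (parrow (dstar beta))) => [w' _ _ _ wp'|/eqP[]]; last by rewrite wt; apply: val_inj.
by rewrite word_funU wp' wp /= => /eqP; rewrite oner_eq0.
Qed.

(** The k-span as membership in every subspace containing [G], which avoids carrying coefficients
    through inductions. *)
Definition kspan (G : seq L) (z : L) : Prop := forall P : L -> Prop, P 0 ->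
  (forall c x y, P x -> P y -> P (kscale c x + y)) -> (forall g, g \in G -> P g) -> P z.

Lemma kspan0 G : kspan G 0. Proof. by move=> P. Qed.

Lemma kspanP G c x y : kspan G x -> kspan G y -> kspan G (kscale c x + y).
Proof. by move=> Gx Gy P P0 PD PG; apply: (PD); [exact: (Gx P)|exact: (Gy P)]. Qed.

Lemma kspan_gen G g : g \in G -> kspan G g.
Proof. by move=> Gg P _ _; apply. Qed.

Lemma kspan_nth G i : (i < size G)%N -> kspan G (nth 0 G i).
Proof. by move=> iG; apply: kspan_gen; apply: mem_nth. Qed.

Lemma kspanZ G c x : kspan G x -> kspan G (kscale c x).
Proof. by move=> Gx; rewrite -[kscale c x]addr0; apply: kspanP => //; apply: kspan0. Qed.

Lemma kspan_mul G G' w z : kspan G z -> (forall g, g \in G -> kspan G' (w * g)) ->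
  kspan G' (w * z).
Proof.
move=> Gz Gw; apply: (Gz (fun z => kspan G' (w * z))) => //.
- by rewrite mulr0; apply: kspan0.
- by move=> c x y hx hy; rewrite mulrDr Lam_kscaleAr; apply: kspanP.
Qed.

(** [A * Y] is absent from degree 1, being a multiple of [A * X]; the last case is meant for degree
    2. *)
Definition Lam_gens (n : nat) : seq L :=
  match n with
  | 0 => [:: E vtx2; A]
  | 1 => [:: X; Y; B'; A * X]
  | _ => [:: T; W]
  end.

(** A multiplication table on the generators; the relations enter through [Lam_AY], [Lam_BsX],
    [Lam_XX] and [Lam_AW]. *)
Lemma kspan_arrow n (a : arr D) z : (n + (if a is inr _ then 1 else 0) <= 2)%N ->
  kspan (Lam_gens n) z ->
  kspan (Lam_gens (n + (if a is inr _ then 1 else 0))) (Lam_pi v (arrow k a) * z).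
Proof.
have gen m i := @kspan_nth (Lam_gens m) i.
case: n => [|[|[|//]]]; case: a => // a _ /kspan_mul; apply => g.
all: rewrite !inE => h; elim/A3_arrP: a; move: h.
- by move=> /orP[]/eqP->; rewrite Lam0E; [exact: (gen 0%N 1%N)|exact: kspan0].
- by move=> /orP[]/eqP->; rewrite Lam0E; exact: kspan0.
- by move=> /orP[]/eqP->; rewrite ?Lam0E; [exact: kspan0|exact: (gen 1%N 0%N)].
- by move=> /orP[]/eqP->; rewrite ?Lam0E; [exact: (gen 1%N 2%N)|exact: kspan0].
- move=> /or4P[]/eqP->.
  + exact: (gen 1%N 3%N).
  + by rewrite Lam_AY; apply: kspanZ; exact: (gen 1%N 3%N).
  + by rewrite Lam0E; exact: kspan0.
  + by rewrite mulrA Lam0E mul0r; exact: kspan0.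
- move=> /or4P[]/eqP->.
  + by rewrite mulrA Lam0E mul0r; exact: kspan0.
  + by rewrite mulrA Lam0E mul0r; exact: kspan0.
  + exact: (gen 1%N 1%N).
  + by rewrite mulrA Lam0E mul0r; exact: kspan0.
- move=> /or4P[]/eqP->.
  + by rewrite mulrA Lam0E mul0r; exact: kspan0.
  + by rewrite mulrA Lam0E mul0r; exact: kspan0.
  + by rewrite Lam0E; exact: kspan0.
  + by rewrite mulrA Lam_XX; apply: kspanZ; exact: (gen 2%N 1%N).
- move=> /or4P[]/eqP->.
  + by rewrite Lam_BsX; apply: kspanZ; exact: (gen 2%N 0%N).
  + exact: (gen 2%N 0%N).
  + by rewrite Lam0E; exact: kspan0.
  + by rewrite mulrA Lam0E mul0r; exact: kspan0.
- by move=> /orP[]/eqP->; rewrite ?Lam_AW ?(mulrA A) ?Lam0E ?mul0r; exact: kspan0.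
- move=> /orP[]/eqP->.
    by rewrite mulrA; exact: (gen 2%N 1%N).
  by rewrite !mulrA Lam0E !mul0r; exact: kspan0.
Qed.

Lemma kspan_path (p : qpath D) : (nstar p <= 2)%N ->
  kspan (Lam_gens (nstar p)) (Lam_pi v (path_elt k p) * E vtx2).
Proof.
move en : (parrs p) => s; elim: s p en => [|a s IH] p ep.
  have -> : p = ptriv (psrc p) by apply: qpathP.
  move=> _; rewrite -[path_elt k _]/(idem k _) -rmorphM idem_idemM.
  case: eqP => _; last by rewrite rmorph0; apply: kspan0.
  exact: (@kspan_nth (Lam_gens 0) 0).
have := valP p; rewrite -/(psrc p) -/(parrs p) ep /= => /andP[/eqP sa ws].
pose q : qpath D := exist _ (tgt a, s) ws.
have -> : path_elt k p = arrow k a * path_elt k q.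
  rewrite path_eltM /path_mul; case: pcompE => [t _ e1 _ e2|/eqP[]//].
  by congr path_elt; apply: qpathP; rewrite ?e1 ?e2 // ep.
have -> : nstar p = (nstar q + (if a is inr _ then 1 else 0))%N.
  by rewrite /nstar ep /= addnC; case: (a).
move=> np; rewrite rmorphM -mulrA; apply: kspan_arrow => //.
by apply: IH => //; apply: leq_trans np; apply: leq_addr.
Qed.

Lemma kspan_Lam_e n (y : Lam_e v n vtx2) : (n <= 2)%N -> kspan (Lam_gens n) (val y).
Proof.
move=> n2; have /asboolP[_ [[f [hf ->]] ->]] := valP y.
rewrite (pathalgE f) rmorph_sum /= mulr_suml big_seq.
apply: big_ind => [|z w hz hw|p pf]; first exact: kspan0.
  by rewrite -[z]kscale1; apply: kspanP.
rewrite pscaleE Lam_pi_pscale Lam_kscaleAl; apply: kspanZ.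
by rewrite -(hf p pf); apply: kspan_path; rewrite (hf p pf).
Qed.

Lemma kspan2 g h z : kspan [:: g; h] z -> exists c d, z = kscale c g + kscale d h.
Proof.
move=> /(_ (fun z => exists c d, z = kscale c g + kscale d h)); apply.
- by exists 0, 0; rewrite !kscale0l addr0.
- move=> c _ _ [d [d' ->]] [e [e' ->]]; exists (c * d + e), (c * d' + e').
  by rewrite !kscaleDl kscaleDr !kscaleA addrACA.
- move=> w; rewrite !inE => /orP[]/eqP->.
    by exists 1, 0; rewrite kscale1 kscale0l addr0.
  by exists 0, 1; rewrite kscale1 kscale0l add0r.
Qed.

Lemma Lam_rho2_E2 : Lam_rho v ^+ 2 * E vtx2 = kscale (u2 * u2 * (1 - b - b + r)) W.
Proof.
(* Only the summand of [vrho v] at vertex 2 survives. *)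
have rE : Lam_rho v * E vtx2 = kscale u2 (Y - X).
  rewrite /Lam_rho vrhoE rmorphB rmorphD /= !Lam_pi_pscale rmorphB !rmorphM /=.
  rewrite mulrBl mulrDl !Lam_kscaleAl mulrBl -!mulrA !Lam0E !mulr0.
  by rewrite !kscale0r add0r subr0.
(* Inserting [E vtx2] in front of [Y - X] lets [rE] be applied a second time. *)
have EYX : E vtx2 * (Y - X) = Y - X.
  by rewrite mulrBr !mulrA !Lam_idem_arrow.
have -> : Lam_rho v ^+ 2 * E vtx2 = kscale u2 (kscale u2 ((Y - X) * (Y - X))).
  by rewrite expr2 -mulrA rE Lam_kscaleAr -{1}EYX mulrA rE Lam_kscaleAl.
have -> : (Y - X) * (Y - X) = kscale (1 - b - b + r) W; last by rewrite !kscaleA mulrA.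
have zmodE (w p q : L) : (w - p) - (p - q) = w - p - p + q by rewrite opprB addrA addrAC.
rewrite mulrBr (mulrBl Y) (mulrBl X) Lam_XY Lam_YX Lam_XX zmodE.
by rewrite (kscaleDl (1 - b - b)) (kscaleDl (1 - b)) (kscaleDl 1) kscaleN kscale1.
Qed.

End LambdaSpan.

(** * From inverse weights to v_1 + 2 v_2 + v_3, and the conclusion *)

Lemma regular_inverse (k : fieldType) (v : vert A3 -> k) : regular v ->
  let: u1 := (v vtx1)^-1 in let: u2 := (v vtx2)^-1 in let: u3 := (v vtx3)^-1 in
  [/\ u2 != 0, u1 + u2 != 0, u2 + u3 != 0,
      u2 * u2 - (u1 + u2) * (u2 + u3) != 0 &
      let: b := (u2^-1 * (u2 + u3))%R in
      (u2 * u2 * (1 - b - b + (u1 + u2)^-1 * (u2 * b)) != 0)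
      = (v vtx1 + 2%:R * v vtx2 + v vtx3 != 0)].
Proof.
move=> /regular_neq0[v1 v2 v3 [v12 v23 v123]].
have e12 : (v vtx1)^-1 + (v vtx2)^-1 = (v vtx1 + v vtx2) / (v vtx1 * v vtx2).
  by field; rewrite v1 v2.
have e23 : (v vtx2)^-1 + (v vtx3)^-1 = (v vtx2 + v vtx3) / (v vtx2 * v vtx3).
  by field; rewrite v2 v3.
rewrite e12 e23 /=; split.
- by rewrite invr_eq0.
- by rewrite mulf_neq0 ?invr_eq0 ?mulf_neq0.
- by rewrite mulf_neq0 ?invr_eq0 ?mulf_neq0.
- rewrite (_ : _ - _ = - (v vtx1 + v vtx2 + v vtx3) / (v vtx1 * v vtx2 * v vtx3)).
    by rewrite mulf_neq0 ?oppr_eq0 ?invr_eq0 ?mulf_neq0.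
  by field; rewrite v1 v2 v3.
(* Here [b = (v2 + v3) / v3] and [r = v1 (v2 + v3) / (v3 (v1 + v2))], so the numerator of
   [1 - 2 b + r] is [- v2 (v1 + 2 v2 + v3)]. *)
- rewrite (_ : _ * (1 - _ - _ + _) = - (v vtx1 + 2%:R * v vtx2 + v vtx3)
      / (v vtx2 * v vtx3 * (v vtx1 + v vtx2))).
  by rewrite mulf_eq0 oppr_eq0 invr_eq0 !mulf_eq0 (negbTE v2) (negbTE v3) (negbTE v12) !orbF.
  by field; rewrite v12 v3 v2 oner_eq0 v1.
Qed.

Theorem proposition1p27 (k : fieldType) (v : vert A3 -> k) (hv : regular v) :
  minimal_left_rad2_approx
    (@rho2 k A3 v vtx2 : {linear Lam_mod v 0 vtx2 -> Lam_mod v 2 vtx2})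
  <-> v vtx1 + 2%:R * v vtx2 + v vtx3 != 0.
Proof.
have [u2 u12 u23 u123 <-] := regular_inverse hv.
pose al := Lam_pi v (arrow k (@darr A3 alpha)).
pose be := Lam_pi v (arrow k (@darr A3 beta)).
pose als := Lam_pi v (arrow k (@dstar A3 alpha)).
pose bes := Lam_pi v (arrow k (@dstar A3 beta)).
pose E (i : vert (dquiver A3)) := Lam_pi v (idem k i).
have EE i : E i * E i = E i by rewrite -rmorphM idem_idemM eqxx.
have mE : E vtx2 \in @Lam_e_pred k A3 v 0 vtx2.
  apply/asboolP; exists (E vtx2); rewrite EE; split=> //.
  by exists (idem k (vtx2 : vert (dquiver A3))); split=> //; apply: homogU.
have mT : bes * (be * bes) \in @Lam_e_pred k A3 v 2 vtx2.
  apply/asboolP; exists (bes * (be * bes)); split; last first.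
    by rewrite -!mulrA /bes Lam_arrow_idem.
  exists (arrow k (@dstar A3 beta) * (arrow k (@darr A3 beta) * arrow k (@dstar A3 beta))).
  split; last by rewrite !rmorphM.
  exact: (homogM (homog_arrow (a := dstar beta))
            (homogM (homog_arrow (a := darr beta)) (homog_arrow (a := dstar beta)))).
have inclA (a : arr A3) : incl (arrow k a) = arrow k (@darr A3 a) :> pathalg k (dquiver A3).
  by rewrite /arrow inclU; congr path_elt; apply: qpathP.
have inclE (i : vert A3) : incl (idem k i) = idem k (i : vert (dquiver A3)).
  by rewrite /idem inclU; congr path_elt; apply: qpathP.
pose x : Lam_mod v 0 vtx2 := exist _ (E vtx2) mE.
pose y : Lam_mod v 2 vtx2 := exist _ (bes * (be * bes)) mT.
have vx : val (arrow k alpha *: x) = al.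
  by rewrite val_Lam_scale inclA /= /E Lam_arrow_idem.
have vy : val (arrow k beta *: y) = be * bes * (be * bes).
  by rewrite val_Lam_scale inclA /= mulrA.
have W0 : be * bes * (be * bes) <> 0 := Lam_W_neq0 u2 u12.
(* The scalar [c] of the criterion is the coefficient in [Lam_rho2_E2]; what remains are the
   conditions on the generators [x] and [y]. *)
apply: (@minimal_left_rad2_approx_P2 k _ _ x y).
- move=> z; have [c [d zE]] := kspan2 (kspan_Lam_e u2 u12 u123 z isT).
  exists (c *: (1 : pathalg k A3) + d *: arrow k alpha).
  rewrite scale_comb; apply: val_inj; rewrite zE.
  by rewrite raddfD /= !val_Lam_kscale vx.
- by apply: val_inj; rewrite val_Lam_scale inclE /= EE.
(* If [al] vanished in [Lam v], so would [Y * X], which is a nonzero multiple of [W]. *)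
- move=> /(congr1 val); rewrite vx => al0; apply: W0.
  apply: kscale_inj (esym (etrans _ (Lam_YX u2))); last by rewrite -/al al0 !mulr0.
  by apply: mulf_neq0; rewrite // invr_eq0.
- move=> z; have [c [d zE]] := kspan2 (kspan_Lam_e u2 u12 u123 z isT).
  exists (c *: (1 : pathalg k A3) + d *: arrow k beta).
  rewrite scale_comb; apply: val_inj; rewrite zE.
  by rewrite raddfD /= !val_Lam_kscale vy.
- by apply: val_inj; rewrite val_Lam_scale inclE /= mulrA /E Lam_idem_arrow.
- by move=> /(congr1 val); rewrite vy.
- apply: val_inj; rewrite val_Lam_scale inclA vy.
  exact: Lam_AW.
- apply: val_inj; rewrite val_Lam_kscale vy; exact: Lam_rho2_E2.
Qed.
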